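(* For every $n\ge0$, the dimension of the space of doubly symmetric functions that are homogeneous of degree $n$ is the coefficient of $x^n$ in $$\prod_{k\ge0}(1-x^{2k+1})^{-1}=\prod_{k\ge1}(1+x^k).$$
   Context: Symmetric functions are taken over $\mathbb{Q}$, with basis the Schur functions $S_\lambda$ indexed by all partitions (including the empty one). Hook Schur functions: for finite, possibly empty, lists of variables $X=(x_1,\ldots,x_k)$, $Y=(y_1,\ldots,y_\ell)$, a $(k,\ell)$-semistandard tableau of shape $\lambda$ is a filling of the Young diagram of $\lambda$ with entries from the ordered alphabet $1<2<\cdots<k<1'<\cdots<\ell'$ such that entries are non-decreasing in each row and each column, unprimed symbols may repeat in rows but not in columns, and primed symbols may repeat in columns but not in rows. Then $HS_\lambda(X;Y)=\sum_T x^T$, summed over all such tableaux $T$, where $x^T=\prod_j x_j^{\#\{j \text{ in } T\}}\prod_j y_j^{\#\{j'\text{ in }T\}}$. A symmetric function $\sum_\lambda m_\lambda S_\lambda$ is doubly symmetric if for all finite (possibly empty) sets of variables $X,Y$ one has $\sum_\lambda m_\lambda S_\lambda(X,Y)=\sum_\lambda m_\lambda HS_\lambda(X;Y)$, where $S_\lambda(X,Y)$ is the Schur polynomial in all the variables of $X$ and $Y$ together. *)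

(* Defs.v *)
From HB Require Import structures.
From mathcomp Require Import all_boot all_order all_algebra.
From mathcomp Require Import -(notations) monalg.
From mathcomp Require Import finmap mpoly.

Set Implicit Arguments.
Unset Strict Implicit.
Unset Printing Implicit Defensive.

Import GRing.Theory.
Local Open Scope ring_scope.

Definition is_part (s : seq nat) : bool := sorted geq s && (0%N \notin s).

Record part := Part { parts :> seq nat; _ : is_part parts }.
HB.instance Definition _ := [isSub for parts].
HB.instance Definition _ := [Choice of part by <:].

(* A cell is a dependent pair: a row index [tag c] and, inside that row,
   a column index [tagged c]; both start at 0. *)
Definition cell (la : part) : finType :=
  {i : 'I_(size la) & 'I_(nth 0%N la i)}.

Definition row (la : part) (c : cell la) : nat := tag c.
Definition col (la : part) (c : cell la) : nat := tagged c.

Definition filling (la : part) (N : nat) := {ffun cell la -> 'I_N}.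

Definition left_of (la : part) (c d : cell la) : bool :=
  (row c == row d) && (col c < col d)%N.
Definition above (la : part) (c d : cell la) : bool :=
  (col c == col d) && (row c < row d)%N.

Definition weight (la : part) (N : nat) (T : filling la N) : {mpoly rat[N]} :=
  \prod_(j < N) 'X_j ^+ #|[set c | T c == j]|.

Definition ssyt (la : part) (N : nat) (T : filling la N) : bool :=
  [forall c, forall d,
    (left_of c d ==> (T c <= T d)%N) && (above c d ==> (T c < T d)%N)].

Definition schur (N : nat) (la : part) : {mpoly rat[N]} :=
  \sum_(T : filling la N | ssyt T) weight T.

(* The alphabet 1 < ... < k < 1' < ... < l' is encoded by ['I_(k + l)] with
   its usual order: the letters smaller than [k] are the unprimed ones.
   Correspondingly, X consists of the first k variables of [{mpoly rat[k + l]}]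
   and Y of the last l ones. *)
Definition unprimed (k l : nat) (a : 'I_(k + l)) : bool := (a < k)%N.

Definition hook_ssyt (k l : nat) (la : part) (T : filling la (k + l)) : bool :=
  [forall c, forall d,
    [&& left_of c d || above c d ==> (T c <= T d)%N,
        left_of c d && (T c == T d) ==> unprimed (T c)
      & above c d && (T c == T d) ==> ~~ unprimed (T c)]].

Definition hook_schur (k l : nat) (la : part) : {mpoly rat[k + l]} :=
  \sum_(T : filling la (k + l) | hook_ssyt T) weight T.

(* The Q-vector space with basis the Schur functions S_la:
   [monalg.mcoeff la f] is the coefficient m_la of S_la in [f]. *)
Definition symfun := monalg.malg part rat.

Definition doubly_symmetric (f : symfun) : Prop :=
  forall k l : nat,
    \sum_(la <- monalg.msupp f) monalg.mcoeff la f *: schur (k + l) la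
    = \sum_(la <- monalg.msupp f) monalg.mcoeff la f *: hook_schur k l la.

Definition homogeneous (n : nat) (f : symfun) : Prop :=
  forall la : part, la \in monalg.msupp f -> sumn la = n.

(* That [P] is a linear subspace is part of the claim (it is a span);
   [d] is determined by [P]: see [has_dim_unique]. *)
Definition has_dim (F : fieldType) (V : lmodType F) (P : V -> Prop) (d : nat)
    : Prop :=
  exists b : 'I_d -> V,
    (forall c : 'I_d -> F, \sum_(i < d) c i *: b i = 0 -> forall i, c i = 0)
    /\ (forall v : V, P v <-> exists c : 'I_d -> F, v = \sum_(i < d) c i *: b i).

Definition fps := nat -> rat.

Definition fps_one : fps := fun n => (n == 0%N)%:R.
Definition fps_X (m : nat) : fps := fun n => (n == m)%:R.
Definition fps_add (f g : fps) : fps := fun n => f n + g n.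
Definition fps_sub (f g : fps) : fps := fun n => f n - g n.
Definition fps_mul (f g : fps) : fps :=
  fun n => \sum_(i < n.+1) f i * g (n - i)%N.

(* The list of the coefficients of degrees 0, ..., n of 1 / f. *)
Fixpoint fps_inv_coefs (f : fps) (n : nat) : seq rat :=
  if n is m.+1 then
    let s := fps_inv_coefs f m in
    rcons s (- (f 0%N)^-1 * \sum_(i < m.+1) f i.+1 * s`_(m - i))
  else [:: (f 0%N)^-1].

(* Meaningful when [f 0 != 0]: see [fps_mulV]. *)
Definition fps_inv (f : fps) : fps := fun n => (fps_inv_coefs f n)`_n.

(* Convergence is the formal one: each coefficient of the partial products
   is eventually constant; P is determined up to pointwise equality:
   see [is_fps_prod_unique]. *)
Definition is_fps_prod (F : nat -> fps) (P : fps) : Prop :=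
  forall n : nat, exists N0 : nat, forall N : nat, (N0 <= N)%N ->
    (\big[fps_mul/fps_one]_(k < N) F k) n = P n.

Lemma size_fps_inv_coefs f n : size (fps_inv_coefs f n) = n.+1.
Proof. by elim: n => //= n IH; rewrite size_rcons IH. Qed.

Lemma nth_fps_inv_coefs f n i : (i <= n)%N -> (fps_inv_coefs f n)`_i = fps_inv f i.
Proof.
elim: n => [|n IH]; first by rewrite leqn0 => /eqP->.
rewrite leq_eqVlt => /orP[/eqP-> //|lt_in].
by rewrite /= nth_rcons size_fps_inv_coefs lt_in IH.
Qed.

Lemma fps_mulV f : f 0%N != 0 -> fps_mul f (fps_inv f) =1 fps_one.
Proof.
move=> f0 [|n]; first by rewrite /fps_mul big_ord1 /= mulfV.
rewrite /fps_mul big_ord_recl subn0 {1}/fps_inv /=.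
rewrite nth_rcons size_fps_inv_coefs ltnn eqxx mulrA mulrN mulfV // mulN1r.
apply/eqP; rewrite addrC subr_eq0; apply/eqP/eq_bigr => i _.
by rewrite subSS nth_fps_inv_coefs // leq_subr.
Qed.

Lemma is_fps_prod_unique F P Q : is_fps_prod F P -> is_fps_prod F Q -> P =1 Q.
Proof.
move=> FP FQ n; have [N1 H1] := FP n; have [N2 H2] := FQ n.
by rewrite -(H1 (maxn N1 N2)) ?leq_maxl // H2 // leq_maxr.
Qed.

Lemma has_dim_le (F : fieldType) (V : lmodType F) (P : V -> Prop) d e :
  has_dim P d -> has_dim P e -> (d <= e)%N.
Proof.
move=> [b [fb Pb]] [b' [_ Pb']].
have exA i : exists c : {ffun 'I_e -> F}, b i == \sum_j c j *: b' j.
  have /Pb' [c ->] : P (b i).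
    apply/Pb; exists (fun j => (j == i)%:R).
    rewrite (bigD1 i) //= eqxx scale1r big1 ?addr0 // => j /negPf ->.
    by rewrite scale0r.
  exists [ffun j => c j]; apply/eqP/eq_bigr => j _; by rewrite ffunE.
pose A := \matrix_(i < d, j < e) xchoose (exA i) j.
have bA i : b i = \sum_j A i j *: b' j.
  rewrite {1}(eqP (xchooseP (exA i))); by apply: eq_bigr => j _; rewrite mxE.
suff /eqP <- : row_free A by apply: rank_leq_col.
rewrite -kermx_eq0; apply/eqP/row_matrixP => i; rewrite row0.
apply/rowP => j; rewrite [RHS]mxE.
have kA : matrix.row i (kermx A) *m A = 0 by rewrite -row_mul mulmx_ker row0.
apply: (fb (fun j => matrix.row i (kermx A) 0 j)).
under eq_bigr => k _ do rewrite bA scaler_sumr.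
rewrite exchange_big big1 //= => k _.
under eq_bigr => j' _ do rewrite scalerA.
rewrite -scaler_suml; move/rowP/(_ k): kA; rewrite !mxE => ->.
by rewrite scale0r.
Qed.

Lemma has_dim_unique (F : fieldType) (V : lmodType F) (P : V -> Prop) d e :
  has_dim P d -> has_dim P e -> d = e.
Proof. by move=> Pd Pe; apply/eqP; rewrite eqn_leq !(has_dim_le (P := P)). Qed.

(* Main.v *)
(* The operators h_k^perp and e_k^perp on partitions (removal of a horizontal,
   resp. vertical, strip of size k) compute the coefficients of S_lambda and of
   HS_lambda when the tableaux are peeled off one letter at a time, so f is doubly
   symmetric if and only if h_k^perp f = e_k^perp f for all k.  With the power
   sums p_k^perp, defined by t H'(t) / H(t), the ratio of the generating series is
   H(t) / E(t) = exp (sum_k p_(2k) t^(2k) / k), so the condition becomes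
   p_(2k)^perp f = 0 for all k >= 1.  The functionals f |-> <p_rho, f>, for rho
   a partition of n, form a basis of the dual of degree n; f is doubly symmetric
   if and only if those with an even part in rho kill f.  The dimension is thus
   the number of partitions of n into odd parts.

   The operators are represented by matrices indexed by the partitions of size
   at most n, a set which is closed under removing strips. *)
From HB Require Import structures.
From mathcomp Require Import all_boot all_order all_algebra.
From mathcomp Require Import -(notations) monalg.
From mathcomp Require Import finmap mpoly.
From mathcomp Require Import zify ring lra.
Require Import Defs.

Set Implicit Arguments.
Unset Strict Implicit.
Unset Printing Implicit Defensive.

Import GRing.Theory Num.Theory.
Local Open Scope ring_scope.

(** * Truncated power series and Euler's identity *)

(** Double symmetry only compares polynomials, that is, what remains of [f] after all letters have
    been peeled off: the coefficient of the empty Schur function. To recover an equality of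
    operators, words in the h_k^perp followed by this coefficient are shown to separate vectors; a
    single primed letter on top of arbitrarily many unprimed ones then suffices. Newton's identities
    carry the separation over to words in the p_k^perp, which makes the table of the numbers <p_rho,
    S_lambda> invertible. Logarithms of matrix-valued series are avoided: the even p_k^perp are
    isolated by comparing the Newton recursions of H and E, which differ only in signs. These rest
    on two involutions on strips: one proves that the h_k^perp commute, a sign-reversing one that
    E(-t) H(t) = 1. This relation expresses each e_k^perp through the h_k^perp, so the other
    commutations need no further bijection. *)

Definition conv (R : nzRingType) (f g : nat -> R) (n : nat) : R :=
  \sum_(i < n.+1) f i * g (n - i)%N.

(** Congruence modulo ['X^B.+1]. Infinite products enter only through such truncations, which allows
    computing in the ring of polynomials. *)
Definition eqp_upto (R : nzRingType) (B : nat) (p q : {poly R}) : Prop :=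
  forall i, (i <= B)%N -> p`_i = q`_i.

Section Truncation.
Variables (R : nzRingType).
Implicit Types (f g h : nat -> R) (p q : {poly R}).

Definition trunc (B : nat) (f : nat -> R) : {poly R} := \poly_(i < B.+1) f i.

Lemma coef_trunc B f i : (i <= B)%N -> (trunc B f)`_i = f i.
Proof. by move=> iB; rewrite coef_poly ltnS iB. Qed.

Lemma coef_conv B f g p q n :
    (n <= B)%N -> (forall i, (i <= B)%N -> p`_i = f i) ->
    (forall i, (i <= B)%N -> q`_i = g i) ->
  (p * q)`_n = conv f g n.
Proof.
move=> nB Hp Hq; rewrite coefM; apply: eq_bigr => i _.
rewrite Hp ?Hq //; first exact: leq_trans (leq_subr _ _) nB.
by apply: leq_trans nB; rewrite -ltnS.
Qed.

Lemma eq_conv f f' g g' : f =1 f' -> g =1 g' -> conv f g =1 conv f' g'.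
Proof. by move=> ff gg n; apply: eq_bigr => i _; rewrite ff gg. Qed.

(** Inherited from polynomial multiplication after truncation; [R] may be noncommutative, as for the
    matrix coefficients below. *)
Lemma convA f g h : conv f (conv g h) =1 conv (conv f g) h.
Proof.
move=> n; have ct := @coef_trunc n.
rewrite -(@coef_conv n f _ (trunc n f) (trunc n g * trunc n h)) ?mulrA //.
- apply: (@coef_conv n) => // i iB; last exact: ct.
  by apply: coef_conv iB _ _ => j; apply: ct.
- by move=> i; apply: ct.
- by move=> i iB; apply: coef_conv iB _ _ => j; apply: ct.
Qed.

Lemma convf1 f : conv f (fun n => (n == 0%N)%:R) =1 f.
Proof.
move=> n; rewrite /conv big_ord_recr /= subnn mulr1 big1 ?add0r // => i _.
by rewrite subn_eq0 leqNgt ltn_ord mulr0.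
Qed.

Lemma eqp_uptoM B p p' q q' :
  eqp_upto B p p' -> eqp_upto B q q' -> eqp_upto B (p * q) (p' * q').
Proof.
move=> Hp Hq i iB.
by rewrite (coef_conv iB Hp Hq) (@coef_conv B (fun j => p'`_j) (fun j => q'`_j)).
Qed.

Lemma eqp_upto_sym B p q : eqp_upto B p q -> eqp_upto B q p.
Proof. by move=> H i iB; rewrite H. Qed.

Lemma eqp_upto_trans B p q r :
  eqp_upto B p q -> eqp_upto B q r -> eqp_upto B p r.
Proof. by move=> H K i iB; rewrite H ?K. Qed.

End Truncation.

(** A series with nonzero constant term is cancellable: the coefficients of [p] and [q] are matched
    by strong induction on the degree. *)
Lemma eqp_upto_mulIl (F : fieldType) (B : nat) (r p q : {poly F}) :
  r`_0 != 0 -> eqp_upto B (r * p) (r * q) -> eqp_upto B p q.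
Proof.
move=> r0 H i; elim/ltn_ind: i => i IH iB.
have := H i iB; rewrite !coefM !big_ord_recl /= subn0.
rewrite (_ : \sum_(j < i) _ = \sum_(j < i) r`_(lift ord0 j) * q`_(i - lift ord0 j)).
  by move/addIr/(mulfI r0).
apply: eq_bigr => j _; have jlt := ltn_ord j; congr (_ * _).
by apply: IH; rewrite /= /bump leq0n; lia.
Qed.

Lemma coef_fps_mul (B : nat) (f g : fps) (p q : {poly rat}) :
    (forall i, (i <= B)%N -> p`_i = f i) ->
    (forall i, (i <= B)%N -> q`_i = g i) ->
  forall i, (i <= B)%N -> (p * q)`_i = fps_mul f g i.
Proof. by move=> Hp Hq i iB; apply: coef_conv iB Hp Hq. Qed.

Lemma coef_fps_prod (B N : nat) (F : nat -> fps) (p : nat -> {poly rat}) :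
    (forall k i, (i <= B)%N -> (p k)`_i = F k i) ->
  forall i, (i <= B)%N ->
    (\prod_(k < N) p k)`_i = (\big[fps_mul/fps_one]_(k < N) F k) i.
Proof.
move=> H; elim: N => [|N IH] in F p H *.
  by move=> i _; rewrite !big_ord0 coef1.
rewrite !big_ord_recl; apply: coef_fps_mul; first exact: H.
by apply: (IH (fun k => F k.+1) (fun k => p k.+1)) => k; apply: H.
Qed.

(* The partitions of [n] with parts at most [m]; [t] is fuel and has to exceed
   [m + n]. *)
Fixpoint bounded_parts (t m n : nat) : seq (seq nat) :=
  if t is t'.+1 then
    if n is 0 then [:: [::]] else
    if m is m'.+1 then
      bounded_parts t' m' n
        ++ (if (m <= n)%N then map (cons m) (bounded_parts t' m (n - m)) else [::])
    else [::]
  else [::].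

Lemma mem_bounded_parts t m n s : (m + n < t)%N ->
  (s \in bounded_parts t m n)
  = [&& path geq m s, 0%N \notin s & sumn s == n].
Proof.
elim: t m n s => [//|t IH] m n s mnt.
case: n mnt => [|n] mnt.
  case: s => [//|x s]; rewrite /= !inE /=; case: x => [|x] /=; by rewrite ?andbF.
case: m mnt => [|m] mnt.
  case: s => [//|x s]; rewrite /= in_nil in_cons.
  by case: x => [|x] //=; rewrite ?andbF.
rewrite /= mem_cat IH; last by lia.
case: ifP => mn; last first.
  rewrite in_nil orbF; case: s => [//|x s] /=.
  rewrite in_cons; case: (ltngtP x m.+1) => [xm|xm|->] //=.
    by rewrite -ltnS xm.
    by rewrite leqNgt (ltnW xm).
  by rewrite ltnn /=; symmetry; apply/negP => /and3P[_ _ /eqP]; lia.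
case: s => [|x s]; first by rewrite /=; apply/mapP => -[].
rewrite /= in_cons.
have -> : (x :: s \in map (cons m.+1) (bounded_parts t m.+1 (n.+1 - m.+1)))
   = (x == m.+1) && (s \in bounded_parts t m.+1 (n.+1 - m.+1)).
  apply/mapP/andP => [[s' s'in [-> ->]]|[/eqP -> sin]]; first by rewrite eqxx.
  by exists s.
rewrite IH; last by lia.
case: (ltngtP x m.+1) => [xm|xm|->] //=.
- by rewrite orbF -ltnS xm.
- by rewrite orbF leqNgt (ltnW xm).
rewrite ltnn /=; congr [&& _, _ & _]; apply/eqP/eqP; lia.
Qed.

Lemma uniq_bounded_parts t m n : (m + n < t)%N -> uniq (bounded_parts t m n).
Proof.
elim: t m n => [//|t IH] m [|n] //; case: m => [//|m] mnt /=.
rewrite cat_uniq IH /=; last by lia.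
case: ifP => mn //=; rewrite map_inj_uniq ?IH ?andbT; last 2 first.
- by lia.
- by move=> ? ? [].
apply/hasPn => _ /mapP[s _ ->]; rewrite /= mem_bounded_parts; last by lia.
by rewrite /= ltnn.
Qed.

Definition odd_count (m n : nat) : nat :=
  count (all odd) (bounded_parts (m + n).+1 m n).

(** The recursion in [odd_countS] produces a fuel other than the default. Both lists are
    duplicate-free with the same members, so the counts agree. *)
Lemma odd_countE t m n : (m + n < t)%N ->
  odd_count m n = count (all odd) (bounded_parts t m n).
Proof.
move=> mnt; apply/permP/uniq_perm; try exact: uniq_bounded_parts.
by move=> s; rewrite !mem_bounded_parts.
Qed.

Lemma odd_count0 m : odd_count m 0 = 1%N.
Proof. by rewrite /odd_count addn0. Qed.

Lemma odd_count0S n : odd_count 0 n.+1 = 0%N.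
Proof. by []. Qed.

Lemma odd_countS m n : odd_count m.+1 n = (odd_count m n
     + (if odd m.+1 && (m < n)%N then odd_count m.+1 (n - m.+1) else 0))%N.
Proof.
case: n => [|n]; first by rewrite !odd_count0 ltn0 andbF.
have -> : odd_count m.+1 n.+1 = count (all odd) (bounded_parts (m + n.+1).+1 m n.+1
    ++ (if (m < n.+1)%N then
          map (cons m.+1) (bounded_parts (m + n.+1).+1 m.+1 (n.+1 - m.+1)) else [::])).
  by [].
rewrite count_cat; congr (_ + _)%N; case: ltnP => mn; rewrite ?andbF //.
rewrite count_map (@odd_countE (m + n.+1).+1); last by lia.
rewrite andbT; case: ifP => om; first by apply: eq_count => s /=; move: om => /= ->.
by rewrite -[RHS](count_pred0 (bounded_parts (m + n.+1).+1 m.+1 (n.+1 - m.+1)));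
  apply: eq_count => s /=; move: om => /= ->.
Qed.

Lemma odd_count_stable m n : (n <= m)%N -> odd_count m n = odd_count n n.
Proof.
move=> /subnKC <-; elim: (m - n)%N => [|k IH]; first by rewrite addn0.
rewrite addnS odd_countS IH ifF ?addn0 //.
by rewrite [(_ < n)%N]ltnNge leq_addr andbF.
Qed.

Section Euler.
Variable B : nat.
Local Notation "p =B q" := (eqp_upto B p q) (at level 70).

Lemma fps_sub1XE k : trunc B (fps_sub fps_one (fps_X k.+1)) =B 1 - 'X^(k.+1).
Proof.
by move=> i iB; rewrite coef_trunc // coefB coef1 coefXn /fps_sub /fps_one /fps_X.
Qed.

Definition geom (k : nat) : {poly rat} :=
  trunc B (fps_inv (fps_sub fps_one (fps_X k.+1))).

Lemma geomV k : (1 - 'X^(k.+1)) * geom k =B 1.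
Proof.
move=> i iB; have -> : ((1 - 'X^(k.+1)) * geom k)`_i
   = fps_mul (fps_sub fps_one (fps_X k.+1))
       (fps_inv (fps_sub fps_one (fps_X k.+1))) i.
  apply: coef_fps_mul (iB) => j jB; last exact: coef_trunc.
  by rewrite -fps_sub1XE // coef_trunc.
by rewrite fps_mulV ?coef1.
Qed.


(** Partitions using the part 2N+1 are those of n - 2N - 1 with that part adjoined, so the factor
    cancels them; the bound 2N+2 adds nothing, being even. *)
Lemma odd_count_step N :
  trunc B (fun n => (odd_count (2 * N.+1) n)%:R) * (1 - 'X^((2 * N).+1))
    =B trunc B (fun n => (odd_count (2 * N) n)%:R : rat).
Proof.
move=> i iB; rewrite mulrBr mulr1 coefB coefMXn !coef_trunc ?(leq_trans (leq_subr _ _)) //.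
have evenS j : odd_count (2 * N.+1) j = odd_count (2 * N).+1 j.
  have -> : (2 * N.+1)%N = (2 * N).+2 by lia.
  by rewrite odd_countS oddS oddS mul2n odd_double addn0.
rewrite evenS odd_countS oddS {2}mul2n odd_double /=. rewrite natrD ltnS.
case: ltnP => Ni; last by rewrite addr0 subr0.
by rewrite evenS addrK.
Qed.

Lemma geom_prod N :
  \prod_(k < N) geom (2 * k) =B trunc B (fun n => (odd_count (2 * N) n)%:R).
Proof.
elim: N => [|N IH].
  move=> i iB; rewrite big_ord0 coef1 coef_trunc //.
  by case: i {iB} => [|i]; rewrite ?odd_count0 ?odd_count0S.
rewrite big_ord_recr /=; apply: eqp_upto_trans (eqp_uptoM IH (fun _ _ => erefl)) _.
apply: eqp_upto_trans (eqp_uptoM (eqp_upto_sym (@odd_count_step N)) (fun _ _ => erefl)) _.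
rewrite -mulrA; apply: eqp_upto_trans (eqp_uptoM (fun _ _ => erefl) (@geomV _)) _.
by rewrite mulr1.
Qed.

(** A finite form of Euler's argument: (1 + x^k)(1 - x^k) = 1 - x^(2k) supplies the even factors on
    the right. The third product keeps the identity free of division; it is cancelled after
    truncation, where the products up to N and up to 2N agree. *)
Lemma euler_identity N :
  \prod_(k < N) (1 + 'X^(k.+1)) * \prod_(k < N) (1 - 'X^((2 * k).+1))
    * \prod_(k < N) (1 - 'X^(k.+1))
  = \prod_(k < (2 * N)) (1 - 'X^(k.+1)) :> {poly rat}.
Proof.
elim: N => [|N IH]; first by rewrite !big_ord0 !mulr1.
have -> : (2 * N.+1)%N = (2 * N).+2 by lia.
rewrite !big_ord_recr /= -IH.
have -> : 'X^((2 * N).+2) = 'X^(N.+1) * 'X^(N.+1) :> {poly rat}.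
  by rewrite -exprD; congr (_ ^+ _); lia.
by ring.
Qed.

Lemma prod_sub1X_stable N M : (B <= N)%N -> (N <= M)%N ->
  \prod_(k < M) (1 - 'X^(k.+1)) =B (\prod_(k < N) (1 - 'X^(k.+1)) : {poly rat}).
Proof.
move=> BN /subnKC <-; elim: (M - N)%N => [|k IH]; first by rewrite addn0.
rewrite addnS big_ord_recr /=; apply: eqp_upto_trans IH => i iB.
rewrite mulrBr mulr1 coefB coefMXn ifT ?subr0 //; lia.
Qed.

Lemma prod_add1X N : (B <= N)%N ->
  \prod_(k < N) (1 + 'X^(k.+1)) =B trunc B (fun n => (odd_count (2 * N) n)%:R : rat).
Proof.
move=> BN; set S := \prod_(k < N) _.
set O : {poly rat} := \prod_(k < N) (1 - 'X^((2 * k).+1)).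
set E : {poly rat} := \prod_(k < N) (1 - 'X^(k.+1)).
have E0 : E`_0 != 0.
  rewrite /E -horner_coef0 horner_prod prodf_seq_neq0; apply/allP => i _ /=.
  by rewrite hornerD hornerN hornerXn expr0n /= subr0 hornerC oner_eq0.
have SO : S * O =B 1.
  apply: (eqp_upto_mulIl E0); rewrite mulr1 mulrC euler_identity.
  by apply: prod_sub1X_stable => //; lia.
have OG : O * \prod_(k < N) geom (2 * k) =B 1.
  rewrite -big_split /= => i iB; rewrite [in RHS](_ : 1 = \prod_(k < N) 1);
    last by rewrite big1.
  elim/big_rec2: _ i iB => // k x y _ IH.
  by apply: eqp_uptoM IH; apply: geomV.
apply: eqp_upto_trans (@geom_prod N).
rewrite -[S]mulr1; apply: eqp_upto_trans (eqp_uptoM (fun _ _ => erefl) (eqp_upto_sym OG)) _.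
rewrite mulrA; apply: eqp_upto_trans (eqp_uptoM SO (fun _ _ => erefl)) _.
by rewrite mul1r.
Qed.

End Euler.

Definition odd_parts_series : fps := fun n => (odd_count n n)%:R.

Lemma is_fps_prod_odd :
  is_fps_prod (fun k => fps_inv (fps_sub fps_one (fps_X (2 * k + 1)%N)))
    odd_parts_series.
Proof.
move=> n; exists n => N nN.
rewrite -(@coef_fps_prod n N
  (fun k => fps_inv (fps_sub fps_one (fps_X (2 * k + 1))))
  (fun k => geom n (2 * k))) //.
  rewrite (@geom_prod n) // coef_trunc // odd_count_stable //; lia.
by move=> k i iN; rewrite coef_trunc // addn1.
Qed.

Lemma is_fps_prod_add1X :
  is_fps_prod (fun k => fps_add fps_one (fps_X (k + 1)%N)) odd_parts_series.
Proof.
move=> n; exists n => N nN.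
rewrite -(@coef_fps_prod n N
  (fun k => fps_add fps_one (fps_X (k + 1))) (fun k => 1 + 'X^(k.+1))) //.
  rewrite (@prod_add1X n) // coef_trunc // odd_count_stable //; lia.
by move=> k i iN; rewrite coefD coef1 coefXn addn1.
Qed.

(** * Partitions and strips *)

Local Notation rw la i := (nth 0%N (parts la) i).

Lemma is_part_nil : is_part [::]. Proof. by []. Qed.
Definition part0 : part := Part is_part_nil.

Section PartRows.
Implicit Types la mu nu : part.

Lemma part_sorted la : sorted geq la.
Proof. by case: la => s /= /andP[]. Qed.

Lemma part_neq0 la : 0%N \notin (la : seq nat).
Proof. by case: la => s /= /andP[]. Qed.

Lemma row_gt0 la i : (0 < rw la i)%N = (i < size la)%N.
Proof.
case: (ltnP i (size la)) => ila; last by rewrite nth_default.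
by rewrite lt0n; apply: contra (part_neq0 la) => /eqP <-; apply: mem_nth.
Qed.

Lemma row_leS la i : (rw la i.+1 <= rw la i)%N.
Proof.
case: (ltnP i.+1 (size la)) => ila; last by rewrite nth_default.
by have /sortedP := part_sorted la; apply.
Qed.

Lemma row_le la i j : (i <= j)%N -> (rw la j <= rw la i)%N.
Proof.
by move=> /subnKC <-; elim: (j - i)%N => [|k IH]; rewrite ?addn0 // addnS
  (leq_trans (row_leS _ _)).
Qed.

Lemma part_eqP la mu : (forall i, rw la i = rw mu i) -> la = mu.
Proof.
move=> H; apply: val_inj; apply: (@eq_from_nth _ 0%N) => [|i _]; last exact: H.
apply/eqP; rewrite eqn_leq; apply/andP; split; rewrite leqNgt -row_gt0.
  by rewrite H row_gt0 ltnn.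
by rewrite -H row_gt0 ltnn.
Qed.

Lemma sumn_rows la L : (size la <= L)%N -> sumn la = (\sum_(i < L) rw la i)%N.
Proof.
elim: (la : seq nat) L => [|x s IH] [|L] //= sL.
- by rewrite big_ord0.
- by rewrite big1 // => i _; rewrite nth_nil.
- by rewrite big_ord_recl /= (IH L).
Qed.

Lemma size_le_sub la mu : (forall i, (rw mu i <= rw la i)%N) ->
  (size mu <= size la)%N.
Proof.
by move=> H; rewrite leqNgt -row_gt0 -leqNgt (leq_trans (H _)) // nth_default.
Qed.

Lemma sumn_le_sub la mu : (forall i, (rw mu i <= rw la i)%N) ->
  (sumn mu <= sumn la)%N.
Proof.
move=> H; rewrite (sumn_rows (size_le_sub H)) (@sumn_rows la (size la)) //.
exact: leq_sum.
Qed.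

(** Stops at the first zero, because a [part] has no zero entry; for a weakly decreasing [f]
    vanishing at [L] nothing is lost. *)
Fixpoint rows_seq (f : nat -> nat) (L : nat) : seq nat :=
  if L is L'.+1 then
    if f 0%N == 0%N then [::] else f 0%N :: rows_seq (fun i => f i.+1) L'
  else [::].

Definition mkpart f L : part := insubd part0 (rows_seq f L).

Lemma row_mkpart f L i : (forall i, f i.+1 <= f i)%N -> f L = 0%N ->
  rw (mkpart f L) i = f i.
Proof.
move=> fS fL.
have nthE : forall i, nth 0%N (rows_seq f L) i = f i.
  elim: L f fS fL => [|L IH] f fS fL j /=.
    rewrite nth_nil; elim: j => [//|j IHj]; have := fS j; lia.
  case: eqP => f0; last by case: j => [//|j] /=; rewrite IH.
  rewrite nth_nil; elim: j => [//|j IHj]; have := fS j; lia.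
suff rP : is_part (rows_seq f L) by rewrite /mkpart val_insubd rP nthE.
apply/andP; split.
  by apply/(sortedP 0%N) => j _; rewrite !nthE; apply: fS.
elim: L f {fS fL nthE} => [//|L IH] f /=; case: ifP => // f0.
by rewrite in_cons negb_or IH eq_sym f0.
Qed.

(* [la / mu] is a horizontal strip if [b] is [true], a vertical strip otherwise. *)
Definition strip (b : bool) la mu : bool :=
  all (fun i => (rw mu i <= rw la i)
         && (if b then rw la i.+1 <= rw mu i else rw la i <= (rw mu i).+1))%N
      (iota 0 (maxn (size la) (size mu))).

Lemma stripP b la mu :
  reflect (forall i, (rw mu i <= rw la i)%N
      /\ (if b then rw la i.+1 <= rw mu i else rw la i <= (rw mu i).+1)%N)
    (strip b la mu).
Proof.
apply: (iffP allP) => [H i|H i _]; last by have [-> ->] := H i.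
case: (ltnP i (maxn (size la) (size mu))) => iL.
  by apply/andP/H; rewrite mem_iota.
move: iL; rewrite geq_max => /andP[lai mui].
by rewrite !nth_default // ?leqW //; case: ifP.
Qed.

Lemma strip_sub b la mu i : strip b la mu -> (rw mu i <= rw la i)%N.
Proof. by move=> /stripP/(_ i)[]. Qed.

Lemma strip_refl b la : strip b la la.
Proof. by apply/stripP => i; split=> //; case: b; rewrite ?row_leS. Qed.

Lemma sub_sumn_eq la mu : (forall i, (rw mu i <= rw la i)%N) ->
  sumn la = sumn mu -> la = mu.
Proof.
move=> le; rewrite (sumn_rows (leqnn (size la))) (sumn_rows (size_le_sub le)) => E.
apply: part_eqP => i; case: (ltnP i (size la)) => ila; last first.
  by rewrite !nth_default // (leq_trans (size_le_sub le)).
apply/eqP; rewrite eqn_leq le andbT leqNgt; apply/negP => lt.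
move: E; rewrite (bigD1 (Ordinal ila)) //= [in RHS](bigD1 (Ordinal ila)) //=.
apply/eqP; rewrite gtn_eqF // -addSn; apply: leq_add => //.
by apply: leq_sum.
Qed.

End PartRows.

Lemma count_inj (T : eqType) (s : seq T) (P Q : pred T) (f : T -> T) :
    uniq s -> {in s, forall x, P x -> (f x \in s) && Q (f x)} ->
    {in s &, forall x y, P x -> P y -> f x = f y -> x = y} ->
  (count P s <= count Q s)%N.
Proof.
move=> us fP finj; rewrite -!size_filter -(size_map f); apply: uniq_leq_size.
  rewrite map_inj_in_uniq ?filter_uniq // => x y.
  rewrite !mem_filter => /andP[Px xs] /andP[Py ys]; exact: finj.
move=> _ /mapP[x + ->]; rewrite mem_filter => /andP[Px xs].
by rewrite mem_filter andbC fP.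
Qed.

Definition part_tail (la : part) : part :=
  mkpart (fun i => rw la i.+1) (size la).

Lemma row_part_tail (la : part) i : rw (part_tail la) i = rw la i.+1.
Proof.
by apply: row_mkpart => [j|]; rewrite ?row_leS // nth_default.
Qed.

Lemma sumn_part_tail (la : part) : sumn la = (rw la 0 + sumn (part_tail la))%N.
Proof.
have le i : (rw (part_tail la) i <= rw la i)%N by rewrite row_part_tail row_leS.
rewrite (sumn_rows (size_le_sub le)) (@sumn_rows la (size la).+1) //.
by rewrite big_ord_recl; congr (_ + _)%N; apply: eq_bigr => i _; rewrite row_part_tail.
Qed.

(** Deleting the first row moves the others up, so each column loses exactly one cell. *)
Lemma strip_part_tail (la : part) : strip true la (part_tail la).
Proof. by apply/stripP => i; rewrite row_part_tail row_leS leqnn. Qed.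

(** Interlacing forces [mu] to contain the tail of [la]; hence a horizontal strip has at most as
    many cells as the first row, with equality only for the tail. *)
Lemma strip_full_row (la mu : part) k : strip true la mu -> sumn la = (sumn mu + k)%N ->
  (rw la 0 <= k)%N -> rw la 0 = k /\ mu = part_tail la.
Proof.
move=> /stripP st sz le0.
have le i : (rw (part_tail la) i <= rw mu i)%N.
  by rewrite row_part_tail; have [] := st i.
have := sumn_le_sub le; move: sz; rewrite sumn_part_tail => sz le'.
by split; [lia | apply: sub_sumn_eq => //; lia].
Qed.

(** * Commutation of the horizontal strip operators *)

Section HorizontalCommute.

(* Once [la] and [nu] are given, the strip conditions confine each [mu_i] to an
   interval, independently of the other rows; reflecting all these intervals
   exchanges the sizes of [la / mu] and [mu / nu]. *)
Definition flip_row (la nu mu : part) (i : nat) : nat :=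
  (maxn (rw nu i) (rw la i.+1)
   + (if i is i'.+1 then minn (rw la i) (rw nu i') else rw la 0) - rw mu i)%N.

Definition flip (la nu mu : part) : part := mkpart (flip_row la nu mu) (size la).

Variables (la nu mu : part).
Hypotheses (lamu : strip true la mu) (munu : strip true mu nu).

Lemma row_flip i : rw (flip la nu mu) i = flip_row la nu mu i.
Proof.
have /stripP H1 := lamu; have /stripP H2 := munu.
apply: row_mkpart => [j|]; rewrite /flip_row.
  move: (H1 j) (H2 j) (H1 j.+1) (H2 j.+1) => /=.
  by case: j => [|j] /=; last move: (H1 j) (H2 j) => /=; lia.
have z : rw la (size la) = 0%N by rewrite nth_default.
move: (H1 (size la)) (H2 (size la)) (row_leS la (size la)).
by case: (size la) z => [|j] /= ->; lia.
Qed.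

Lemma flip_sub : strip true la (flip la nu mu).
Proof.
have /stripP H1 := lamu; have /stripP H2 := munu.
apply/stripP => i; rewrite row_flip /flip_row.
move: (H1 i) (H2 i) => /=.
by case: i => [|i] /=; last move: (H1 i) (H2 i) => /=; lia.
Qed.

Lemma flip_sup : strip true (flip la nu mu) nu.
Proof.
have /stripP H1 := lamu; have /stripP H2 := munu.
apply/stripP => i; rewrite !row_flip /flip_row.
move: (H1 i) (H2 i) (H1 i.+1) (H2 i.+1) => /=.
by case: i => [|i] /=; last move: (H1 i) (H2 i) => /=; lia.
Qed.

(** Row i of [mu] and row i of its flip add up to the two ends of the interval. The lower end
    max(nu_i, la_(i+1)) of row i and the upper end min(la_(i+1), nu_i) of row i+1 sum to nu_i +
    la_(i+1), so all ends together give the two outer sizes. *)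
Lemma flip_sumn : (sumn (flip la nu mu) + sumn mu = sumn la + sumn nu)%N.
Proof.
have /stripP H1 := lamu; have /stripP H2 := munu.
have le1 i : (rw mu i <= rw la i)%N by have [] := H1 i.
have le2 i : (rw nu i <= rw mu i)%N by have [] := H2 i.
have le3 i : (rw (flip la nu mu) i <= rw la i)%N by have /stripP/(_ i)[] := flip_sub.
have sl := size_le_sub le1.
rewrite (@sumn_rows (flip la nu mu) (size la).+1) ?leqW ?(size_le_sub le3) //.
rewrite (@sumn_rows mu (size la).+1) ?leqW //.
rewrite (@sumn_rows la (size la).+1) ?leqW //.
rewrite (@sumn_rows nu (size la).+1) ?leqW ?(leq_trans (size_le_sub le2)) //.
rewrite -!big_split /=.
transitivity (\sum_(i < (size la).+1) (maxn (rw nu i) (rw la i.+1)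
   + (if (i : nat) is i'.+1 then minn (rw la i) (rw nu i') else rw la 0)))%N.
  apply: eq_bigr => i _; rewrite row_flip /flip_row subnK //.
  move: (H1 i) (H2 i) => /=.
  by case: (i : nat) => [|j] /=; last move: (H1 j) (H2 j) => /=; lia.
rewrite !big_split /= big_ord_recr /= [X in (_ + X)%N]big_ord_recl /=.
rewrite [in RHS]big_ord_recl [X in (_ = _ + _ + X)%N]big_ord_recr /=.
have zl j : (size la <= j)%N -> rw la j = 0%N by move=> ?; rewrite nth_default.
have zn j : (size la <= j)%N -> rw nu j = 0%N.
  by move=> /zl z; have := leq_trans (le2 j) (le1 j); rewrite z; case: (rw nu j).
have S : (\sum_(i < size la) maxn (rw nu i) (rw la i.+1)
        + \sum_(i < size la) minn (rw la (bump 0 i)) (rw nu (0 + i))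
    = \sum_(i < size la) rw la (bump 0 i) + \sum_(i < size la) rw nu i)%N.
  by rewrite -!big_split; apply: eq_bigr => i _; rewrite /= /bump leq0n add1n add0n; lia.
by rewrite (zn _ (leqnn _)) (zl _ (leqnSn _)) maxn0 !addn0 addnCA S addnA.
Qed.

End HorizontalCommute.

Lemma flipK la nu mu : strip true la mu -> strip true mu nu ->
  flip la nu (flip la nu mu) = mu.
Proof.
move=> lamu munu; apply: part_eqP => i.
rewrite row_flip ?flip_sub ?flip_sup // /flip_row row_flip // /flip_row.
have /stripP H1 := lamu; have /stripP H2 := munu; move: (H1 i) (H2 i) => /=.
by case: i => [|i] /=; last move: (H1 i) (H2 i) => /=; lia.
Qed.

(** * The sign-reversing involution behind E(-t) H(t) = 1 *)

Section VerticalHorizontal.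

(* In the first row where [nu] is shorter than [la], both [la_i] and [la_i - 1]
   are admissible values of [mu_i]; exchanging them reverses the sign. *)
Definition toggle_row (la nu mu : part) (i : nat) : nat :=
  if i == find (fun j => rw nu j < rw la j)%N (iota 0 (size la))
  then (if rw mu i == rw la i then (rw la i).-1 else rw la i)
  else rw mu i.

Definition toggle (la nu mu : part) : part := mkpart (toggle_row la nu mu) (size la).

Variables (la nu mu : part).
Hypotheses (lamu : strip false la mu) (munu : strip true mu nu) (neq : la != nu).

Local Notation r := (find (fun j => rw nu j < rw la j)%N (iota 0 (size la))).

Lemma toggle_pivot : [/\ (r < size la)%N, (rw nu r < rw la r)%N
  & forall j, (j < r)%N -> rw nu j = rw la j].
Proof.
have le j : (rw nu j <= rw la j)%N.
  exact: leq_trans (strip_sub _ munu) (strip_sub _ lamu).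
have hasr : has (fun j => rw nu j < rw la j)%N (iota 0 (size la)).
  apply: contraR neq => /hasPn H; apply/eqP/part_eqP => j.
  case: (ltnP j (size la)) => jla; last first.
    by rewrite !nth_default // (leq_trans (size_le_sub le)).
  by apply/eqP; rewrite eqn_leq le andbT leqNgt; apply: H; rewrite mem_iota.
have rla : (r < size la)%N by move: hasr; rewrite has_find size_iota.
split=> // [|j jr]; first by have := nth_find 0%N hasr; rewrite nth_iota.
have := before_find 0%N jr; rewrite nth_iota ?(ltn_trans jr) // add0n.
by have := le j; lia.
Qed.

Let H1 i : (rw mu i <= rw la i)%N /\ (rw la i <= (rw mu i).+1)%N.
Proof. by have /stripP := lamu; apply. Qed.

Let H2 i : (rw nu i <= rw mu i)%N /\ (rw mu i.+1 <= rw nu i)%N.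
Proof. by have /stripP := munu; apply. Qed.

Let toggle_row_bound i :
  [/\ (rw nu i <= toggle_row la nu mu i)%N,
      (toggle_row la nu mu i.+1 <= rw nu i)%N,
      (toggle_row la nu mu i <= rw la i)%N
    & (rw la i <= (toggle_row la nu mu i).+1)%N].
Proof.
have [rla nula before] := toggle_pivot; rewrite /toggle_row.
split.
- case: eqP => [->|_]; last by have [] := H2 i.
  by case: eqP; lia.
(* If the toggled row is i+1, then nu_i = la_i because the pivot is the first row of disagreement;
   hence even the value la_(i+1) respects interlacing. *)
- case: eqP => [E|_]; last by have [] := H2 i.
  rewrite before -?E //; have := row_leS la i; case: eqP; lia.
- by case: eqP => _; have [] := H1 i => //; case: eqP; lia.
- case: eqP => [->|_]; last by have [] := H1 i.
  by case: eqP; lia.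
Qed.

Lemma row_toggle i : rw (toggle la nu mu) i = toggle_row la nu mu i.
Proof.
apply: row_mkpart => [j|].
  have [] := toggle_row_bound j; lia.
have [_ _ + _] := toggle_row_bound (size la); rewrite nth_default //; lia.
Qed.

Lemma toggle_sub : strip false la (toggle la nu mu).
Proof. by apply/stripP => i; rewrite row_toggle; have [] := toggle_row_bound i. Qed.

Lemma toggle_sup : strip true (toggle la nu mu) nu.
Proof. by apply/stripP => i; rewrite !row_toggle; have [] := toggle_row_bound i. Qed.

Lemma toggle_sumn : odd (sumn (toggle la nu mu)) = ~~ odd (sumn mu).
Proof.
have [rla nula before] := toggle_pivot.
have ler i : (rw (toggle la nu mu) i <= rw la i)%N by apply: strip_sub toggle_sub.
rewrite (sumn_rows (size_le_sub ler)) (sumn_rows (size_le_sub (fun i => strip_sub i lamu))).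
rewrite (bigD1 (Ordinal rla)) //= [in RHS](bigD1 (Ordinal rla)) //= !oddD -addNb.
congr (_ (+) odd _); last first.
  apply: eq_bigr => i; rewrite -val_eqE row_toggle /toggle_row /= => /negPf ->.
  by [].
rewrite row_toggle /toggle_row eqxx; have [] := H1 r; case: eqP => [->|].
  by case: (rw la r) nula => //= x; rewrite negbK.
by move=> ? ? ?; have -> : rw la r = (rw mu r).+1 by lia.
Qed.

End VerticalHorizontal.

Lemma toggleK la nu mu : strip false la mu -> strip true mu nu -> la != nu ->
  toggle la nu (toggle la nu mu) = mu.
Proof.
move=> lamu munu neq; apply: part_eqP => i.
rewrite row_toggle ?toggle_sub ?toggle_sup // /toggle_row row_toggle // /toggle_row.
have [_ + _] := toggle_pivot lamu munu neq; case: eqP => [<-|//].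
have /stripP/(_ i) := lamu; do 2?case: eqP; lia.
Qed.

(** * Strip operators *)

Section StripOperators.
Variable r : seq part.
Let s := part0 :: r.
Hypothesis s_uniq : uniq s.
Hypothesis s_down : forall la mu : part,
  la \in s -> (forall i, (rw mu i <= rw la i)%N) -> mu \in s.

Local Notation D := (size r).
(** Index 0 is the empty partition, so entry [0 0] of a row vector is the coefficient of the empty
    Schur function. *)
Definition pt (i : 'I_D.+1) : part := nth part0 s i.

Lemma pt_in i : pt i \in s. Proof. exact: mem_nth. Qed.

Lemma pt0 : pt ord0 = part0. Proof. by []. Qed.

Lemma pt_inj : injective pt.
Proof.
move=> i j /eqP; rewrite /pt.
by rewrite (@nth_uniq _ part0 s _ _ (ltn_ord i) (ltn_ord j) s_uniq) => /eqP/val_inj.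
Qed.

Lemma ptP la : la \in s -> exists i, la = pt i.
Proof.
move=> las; have lt : (index la s < D.+1)%N by rewrite -index_mem in las.
by exists (Ordinal lt); rewrite /pt nth_index.
Qed.

Lemma sum_pt (V : nmodType) (F : part -> V) :
  \sum_(i < D.+1) F (pt i) = \sum_(mu <- s) F mu.
Proof. by rewrite (big_nth part0) big_mkord. Qed.

(** Rows are indexed by the larger partition, so these matrices act on row vectors of Schur
    coefficients from the right: [v *m strip_mx b k] holds the coefficients of h_k^perp f or
    e_k^perp f. *)
Definition strip_mx (b : bool) (k : nat) : 'M[rat]_D.+1 :=
  \matrix_(i, j) (strip b (pt i) (pt j) && (sumn (pt i) == sumn (pt j) + k)%N)%:R.

Local Notation H := (strip_mx true).
Local Notation E := (strip_mx false).

Lemma strip_mx0 b : strip_mx b 0 = 1.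
Proof.
apply/matrixP => i j; rewrite !mxE addn0; case: (eqVneq i j) => [->|ij].
  by rewrite strip_refl !eqxx.
case: andP => // -[st /eqP sz]; case/eqP: ij; apply: pt_inj.
by apply: sub_sumn_eq sz => k; apply: strip_sub st.
Qed.

Lemma strip_mxM_count b b' k k' i j : (strip_mx b k * strip_mx b' k') i j
  = (count (fun mu => [&& strip b (pt i) mu, sumn (pt i) == (sumn mu + k)%N,
       strip b' mu (pt j) & sumn mu == (sumn (pt j) + k')%N]) s)%:R.
Proof.
rewrite mxE -sum1_count natr_sum [in RHS]big_mkcond -sum_pt; apply: eq_bigr => x _.
by rewrite !mxE -natrM mulnb -andbA; case: [&& _, _, _ & _].
Qed.

Lemma strip_mx_comm k l : GRing.comm (H k) (H l).
Proof.
(* [flip] is an injection exchanging the two strip sizes; used in both directions, it gives equal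
   counts. *)
suff le k' l' i j : (count (fun mu => [&& strip true (pt i) mu,
       sumn (pt i) == (sumn mu + k')%N, strip true mu (pt j)
       & sumn mu == (sumn (pt j) + l')%N]) s
     <= count (fun mu => [&& strip true (pt i) mu,
       sumn (pt i) == (sumn mu + l')%N, strip true mu (pt j)
       & sumn mu == (sumn (pt j) + k')%N]) s)%N.
  apply/matrixP => i j; rewrite !strip_mxM_count; congr (_%:R).
  by apply/eqP; rewrite eqn_leq !le.
apply: (@count_inj _ _ _ _ (flip (pt i) (pt j))) => // [mu mus|mu mu' _ _].
  move=> /and4P[st1 /eqP sz1 st2 /eqP sz2].
  have fs := flip_sub st1 st2; have fz := flip_sumn st1 st2.
  rewrite (s_down (pt_in i)) => [|x]; last exact: strip_sub fs.
  by rewrite fs flip_sup //=; apply/andP; split; apply/eqP; lia.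
move=> /and4P[st1 _ st2 _] /and4P[st3 _ st4 _] eq.
by rewrite -[LHS](flipK st1 st2) eq flipK.
Qed.

Lemma toggle_sum la nu : la \in s -> la != nu ->
  \sum_(mu <- s | strip false la mu && strip true mu nu)
     (-1) ^+ (sumn mu) = 0 :> rat.
Proof.
move=> las neq; set P := (fun mu => strip false la mu && strip true mu nu).
set S := \sum_(_ <- _ | _) _.
have PT mu : P mu -> P (toggle la nu mu).
  by move=> /andP[h1 h2]; rewrite /P toggle_sub ?toggle_sup.
have TK mu : P mu -> toggle la nu (toggle la nu mu) = mu.
  by move=> /andP[h1 h2]; apply: toggleK.
have Ts mu : P mu -> toggle la nu mu \in s.
  by move=> /andP[h1 h2]; apply: (s_down las) => x; apply: strip_sub (toggle_sub _ _ _).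
have pe : perm_eq [seq x <- s | P x] (map (toggle la nu) [seq x <- s | P x]).
  apply: uniq_perm; rewrite ?filter_uniq //.
    rewrite map_inj_in_uniq ?filter_uniq // => x y.
    rewrite !mem_filter => /andP[Px _] /andP[Py _] eq.
    by rewrite -(TK x Px) eq TK.
  move=> x; rewrite mem_filter; apply/andP/mapP => [[Px xs]|[y + ->]].
    by exists (toggle la nu x); rewrite ?TK // mem_filter PT ?Ts.
  by rewrite mem_filter => /andP[Py ys]; rewrite PT ?Ts.
suff SN : S = - S by lra.
rewrite {1}/S -big_filter (perm_big _ pe) big_map big_filter -sumrN /=.
apply: eq_bigr => mu /andP[h1 h2].
by rewrite -signr_odd toggle_sumn // signrN signr_odd.
Qed.

Definition signed_col (k : nat) : 'M[rat]_D.+1 := (-1) ^+ k *: E k.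

Local Notation S := signed_col.
Local Notation delta := (fun n => (n == 0%N)%:R).

(** This is E(-t) H(t) = 1. In entry (la, nu) the index k is determined by mu, so the sign is
    (-1)^(|la|-|mu|): off the diagonal the terms cancel under [toggle], on it only mu = la
    survives. *)
Lemma conv_colH : conv S H =1 delta.
Proof.
move=> n; rewrite /conv; apply/matrixP => i j.
have -> : (\sum_(k < n.+1) S k * H (n - k)) i j
  = (sumn (pt i) == (sumn (pt j) + n)%N)%:R * (-1) ^+ sumn (pt i)
    * \sum_(mu <- s | strip false (pt i) mu && strip true mu (pt j)) (-1) ^+ sumn mu.
  rewrite summxE.
  under eq_bigr => k _ do rewrite -scalerAl mxE mxE.
  rewrite [in RHS]big_mkcond -sum_pt mulr_sumr.
  under eq_bigr => k _ do rewrite mulr_sumr.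
  rewrite exchange_big; apply: eq_bigr => x _ /=.
  under eq_bigr => k _ do rewrite !mxE -natrM mulnb.
  case: (boolP (strip false (pt i) (pt x))) => [st1|_]; last first.
    by rewrite mulr0 big1 // => k _; rewrite mulr0.
  case: (boolP (strip true (pt x) (pt j))) => [st2|_]; last first.
    by rewrite andbF mulr0 big1 // => k _; rewrite /= andbF mulr0.
  rewrite /=; have le1 := sumn_le_sub (fun k => strip_sub k st1).
  have le2 := sumn_le_sub (fun k => strip_sub k st2).
  case: eqP => [eqn|neqn]; last first.
    rewrite !mul0r big1 // => k _; case: andP; rewrite ?mulr0 // => -[/eqP h1 /eqP h2].
    by case: neqn; have := ltn_ord k; lia.
  have kn : (sumn (pt i) - sumn (pt x) < n.+1)%N by lia.
  rewrite (bigD1 (Ordinal kn)) //= big1 ?addr0 => [|k]; last first.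
    rewrite -val_eqE /= => kne; case: andP; rewrite ?mulr0 // => -[/eqP h1 /eqP h2].
    by move: kne; rewrite h1 addKn eqxx.
  rewrite subnKC // eqxx mul1r /=.
  have -> : (sumn (pt x) == sumn (pt j) + (n - (sumn (pt i) - sumn (pt x))))%N.
    by apply/eqP; lia.
  rewrite mulr1 -exprD -signr_odd -[RHS]signr_odd; congr (_ ^+ nat_of_bool _); lia.
case: (eqVneq i j) => [->|ij].
  case: n => [|n].
    rewrite addn0 eqxx mul1r !mxE eqxx mulrC mulr_suml (big_rem (pt j)) ?pt_in //.
    rewrite !strip_refl big1_seq => [|mu /andP[/andP[st1 st2]]].
      by rewrite /= addr0 -expr2 sqrr_sign.
    have -> : mu = pt j.
      apply: part_eqP => k; apply/eqP; rewrite eqn_leq.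
      by rewrite (strip_sub k st1) (strip_sub k st2).
    by rewrite mem_rem_uniqF.
  by rewrite mxE eqn_leq [(_ + _ <= _)%N]leqNgt addnS ltnS leq_addr andbF !mul0r.
rewrite toggle_sum ?pt_in ?(inj_eq pt_inj) // mulr0.
by case: n => [|n]; rewrite !mxE ?(negPf ij).
Qed.


(** E(-t) H(t) = 1 solves recursively for [S n] as a polynomial in the [H k], so commuting with
    these is enough. *)
Lemma comm_signed_col (x : 'M[rat]_D.+1) :
  (forall k, GRing.comm x (H k)) -> forall n, GRing.comm x (S n).
Proof.
move=> xH; elim/ltn_ind => n IH.
have := conv_colH n; rewrite /conv big_ord_recr /= subnn strip_mx0 mulr1.
move=> /(canRL (addKr _)) ->; apply: commrD.
  apply: commrN; elim/big_rec: _ => [|k y _ IHy]; first exact: commr0.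
  by apply: commrD => //; apply: commrM; [apply: IH | apply: xH].
by case: n {IH} => [|n]; [apply: commr1 | apply: commr0].
Qed.

Lemma strip_mx_comm_col k n : GRing.comm (H k) (S n).
Proof. by apply: comm_signed_col => l; apply: strip_mx_comm. Qed.

Lemma conv_Hcol : conv H S =1 delta.
Proof.
move=> n; rewrite -conv_colH /conv [RHS](reindex_inj rev_ord_inj) /=.
apply: eq_bigr => k _; rewrite subSS strip_mx_comm_col; congr (_ * H _).
by have := ltn_ord k; lia.
Qed.

(** * Power sum operators and Newton's identities *)

Definition degD (f : nat -> 'M[rat]_D.+1) (n : nat) : 'M[rat]_D.+1 := f n *+ n.

(** [degD] is the derivation t d/dt of generating series, and this is its Leibniz rule. *)
Lemma conv_degD (f g : nat -> 'M[rat]_D.+1) n :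
  conv (degD f) g n + conv f (degD g) n = conv f g n *+ n.
Proof.
rewrite /conv -big_split -sumrMnl; apply: eq_bigr => k _ /=.
by rewrite /degD mulrnAl mulrnAr -mulrnDr subnKC // -ltnS.
Qed.

(* The operators adjoint to multiplication by the power sums: the generating
   series is [t H'(t) / H(t)], where [1 / H(t) = E(-t)]. *)
Definition power_mx : nat -> 'M[rat]_D.+1 := conv (degD H) S.

Local Notation p := power_mx.

Lemma power_mx0 : p 0%N = 0.
Proof. by rewrite /p /conv big_ord1 /degD mulr0n mul0r. Qed.

Lemma comm_power_mx (x : 'M[rat]_D.+1) :
  (forall k, GRing.comm x (H k)) -> forall n, GRing.comm x (p n).
Proof.
move=> xH n; rewrite /p /conv; elim/big_rec: _ => [|k y _ IHy]; first exact: commr0.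
apply: commrD => //; apply: commrM; last exact: comm_signed_col.
by rewrite /degD; apply: commrMn.
Qed.

Lemma strip_mx_comm_power k n : GRing.comm (H k) (p n).
Proof. by apply: comm_power_mx => l; apply: strip_mx_comm. Qed.

Lemma power_mx_comm k n : GRing.comm (p k) (p n).
Proof.
by apply: comm_power_mx => l; apply: commr_sym; apply: strip_mx_comm_power.
Qed.

Lemma strip_mx_newton n : H n *+ n = \sum_(k < n.+1) p k * H (n - k).
Proof.
rewrite -[RHS]/(conv p H n) /p -convA (eq_conv (fun _ => erefl) conv_colH).
by rewrite convf1.
Qed.

(** Differentiating S H = 1 gives (t S') H = - S (t H'); multiplying by S on the right and using H S
    = 1 turns this into t S' = - S p. *)
Lemma signed_col_newton n : S n *+ n = - \sum_(k < n.+1) S k * p (n - k).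
Proof.
have D0 m : conv (degD S) H m = - conv S (degD H) m.
  apply/eqP; rewrite -addr_eq0 conv_degD conv_colH.
  by case: m => [|m]; rewrite ?mulr0n // mul0rn.
rewrite -[LHS]/(degD S n) -[LHS](convf1 (degD S)).
rewrite -(eq_conv (fun _ => erefl) conv_Hcol) convA (eq_conv D0 (fun _ => erefl)).
rewrite -[X in - X]/(conv S p n) convA /conv -sumrN.
by apply: eq_bigr => k _; rewrite mulNr.
Qed.

Lemma col_mxE k : E k = (-1) ^+ k *: S k.
Proof. by rewrite /S scalerA -expr2 sqrr_sign scale1r. Qed.

Lemma col_newton n :
  E n *+ n = - \sum_(k < n.+1) (-1) ^+ (n + k) *: (E k * p (n - k)).
Proof.
rewrite {1}col_mxE scalerMnr signed_col_newton scalerN scaler_sumr.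
by congr (- _); apply: eq_bigr => k _; rewrite /S -scalerAl scalerA exprD.
Qed.

Lemma strip_mx_newton_rev n : H n *+ n = \sum_(k < n.+1) H k * p (n - k).
Proof.
rewrite strip_mx_newton [RHS](reindex_inj rev_ord_inj) /=.
apply: eq_bigr => k _; rewrite subSS strip_mx_comm_power; congr (p _ * _).
by have := ltn_ord k; lia.
Qed.

(** The Newton recursions for [v *m H n] and [v *m E n] have opposite signs exactly at the terms
    with n - k even. If the smaller even p_k kill [v], subtraction for even n leaves twice
    [v *m p n]; conversely, with the even terms gone, both recursions coincide and induction
    applies. *)
Lemma row_eq_colP (v : 'rV[rat]_D.+1) :
  (forall k, v *m H k = v *m E k) <-> (forall k, v *m p k.*2 = 0).
Proof.
have mulA (A B : 'M[rat]_D.+1) : v *m (A * B) = v *m A *m B by rewrite mulmxA.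
have mulC (A B : 'M[rat]_D.+1) : GRing.comm A B -> v *m A *m B = v *m B *m A.
  by move=> AB; rewrite -!mulA AB.
have HN n : (v *m H n) *+ n = \sum_(k < n.+1) v *m H k *m p (n - k).
  transitivity (v *m (H n *+ n)); first by rewrite -!scaler_nat -scalemxAr.
  by rewrite strip_mx_newton_rev mulmx_sumr; apply: eq_bigr => k _; rewrite mulA.
have EN n : (v *m E n) *+ n
    = - \sum_(k < n.+1) (-1) ^+ (n + k) *: (v *m E k *m p (n - k)).
  transitivity (v *m (E n *+ n)); first by rewrite -!scaler_nat -scalemxAr.
  rewrite col_newton mulmxN mulmx_sumr; congr (- _).
  by apply: eq_bigr => k _; rewrite -scalemxAr mulA.
have pH0 n k : v *m p n = 0 -> v *m H k *m p n = 0.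
  by move=> vp; rewrite mulC ?vp ?mul0mx //; apply: strip_mx_comm_power.
have sgn n k : (k <= n)%N -> (-1) ^+ (n + k) = (-1) ^+ (odd (n - k)) :> rat.
  by move=> kn; rewrite -signr_odd oddB // oddD.
split=> [HE k|vp].
  suff: forall n, ~~ odd n -> v *m p n = 0 by apply; rewrite odd_double.
  elim/ltn_ind => {k} n IH on.
  have : (v *m H n) *+ n - (v *m E n) *+ n = 0 by rewrite HE subrr.
  rewrite HN EN opprK -big_split big_ord_recl /= big1 ?addr0 => [|k _].
    rewrite strip_mx0 mulmx1 strip_mx0 mulmx1 subn0 sgn // subn0 (negPf on) expr0 scale1r.
    by move/eqP; rewrite -mulr2n -scaler_nat scaler_eq0 pnatr_eq0 => /eqP.
  have kn : (bump 0 k <= n)%N by rewrite /bump; have := ltn_ord k; lia.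
  rewrite -HE sgn //; case: (boolP (odd _)) => o; first by rewrite expr1 scaleN1r subrr.
  by rewrite pH0 ?scaler0 ?addr0 // IH // /bump; have := ltn_ord k; lia.
elim/ltn_ind => n IH; case: n IH => [|n] IH; first by rewrite !strip_mx0.
suff : (v *m H n.+1) *+ n.+1 = (v *m E n.+1) *+ n.+1.
  move/eqP; rewrite -!scaler_nat -subr_eq0 -scalerBr scaler_eq0 pnatr_eq0 /=.
  by rewrite subr_eq0 => /eqP.
rewrite HN EN -sumrN; apply: eq_bigr => k _.
have kn : (k <= n.+1)%N by rewrite -ltnS.
(* The term k = n is not covered by induction; it vanishes because [p 0] is zero. *)
move: (kn); rewrite leq_eqVlt => /orP[/eqP ->|kn'].
  by rewrite subnn power_mx0 !mulmx0 scaler0 oppr0.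
rewrite sgn // -IH //; case: (boolP (odd _)) => o.
  by rewrite expr1 scaleN1r opprK.
have v0 : v *m p (n.+1 - k) = 0 by rewrite -(odd_double_half (n.+1 - k)) (negPf o) add0n vp.
by rewrite pH0 // scaler0 oppr0.
Qed.

(** * Grading, and separation of vectors by words *)

Definition graded (k : nat) (A : 'M[rat]_D.+1) : Prop :=
  forall i j, A i j != 0 -> sumn (pt i) = (sumn (pt j) + k)%N.

Lemma graded_sum k (I : Type) (t : seq I) (P : pred I) (F : I -> 'M[rat]_D.+1) :
  (forall x, P x -> graded k (F x)) -> graded k (\sum_(x <- t | P x) F x).
Proof.
move=> gF; elim/big_ind: _ => // [i j|A B gA gB i j]; first by rewrite mxE eqxx.
rewrite mxE => nz; case: (eqVneq (A i j) 0) => [A0|/gA //].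
by apply: gB; move: nz; rewrite A0 add0r.
Qed.

Lemma gradedZ k a A : graded k A -> graded k (a *: A).
Proof. by move=> gA i j; rewrite mxE mulf_eq0 => /norP[_ /gA]. Qed.

Lemma gradedMn k n A : graded k A -> graded k (A *+ n).
Proof. by rewrite -scaler_nat; apply: gradedZ. Qed.

Lemma gradedM k l A B : graded k A -> graded l B -> graded (k + l) (A * B).
Proof.
move=> gA gB i j; rewrite mxE => nz.
have /existsP[x] : [exists x, A i x * B x j != 0].
  apply: contraR nz => /existsPn H0; apply/eqP/big1 => x _.
  by apply/eqP/negPn/H0.
by rewrite mulf_eq0 => /norP[/gA -> /gB ->]; rewrite addnAC addnA.
Qed.

Lemma graded_strip_mx b k : graded k (strip_mx b k).
Proof.
by move=> i j; rewrite mxE; case: andP => [[_ /eqP]|_] //; rewrite eqxx.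
Qed.

Lemma graded_power_mx k : graded k (p k).
Proof.
apply: graded_sum => i _; rewrite -[k in graded k](subnKC (ltnSE (ltn_ord i))).
apply: gradedM; first by apply/gradedMn/graded_strip_mx.
by apply/gradedZ/graded_strip_mx.
Qed.

Lemma graded_power_prod (rho : seq nat) :
  graded (sumn rho) (\prod_(k <- rho) p k).
Proof.
elim: rho => [|k rho IH]; last first.
  by rewrite big_cons; apply: gradedM IH; apply: graded_power_mx.
rewrite big_nil -(strip_mx0 true); exact: graded_strip_mx.
Qed.

(* If [m] is the largest first row in the support of [v], then [H m] cuts off the
   first row of the partitions with first row [m], and kills the others. *)
Lemma strip_mx_separate (v : 'rV[rat]_D.+1) :
  (forall a : seq nat, (v *m \prod_(k <- a) H k) 0 0 = 0) -> v = 0.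
Proof.
(* Nested induction: [L] bounds the number of rows in the support, [m] the first row. The hypothesis
   on words is inherited by [u *m H m.+1], since this only prepends a letter. *)
suff claim L m (u : 'rV[rat]_D.+1) :
    (forall i, u 0 i != 0 -> (size (pt i) <= L)%N /\ (rw (pt i) 0 <= m)%N) ->
    (forall a : seq nat, (u *m \prod_(k <- a) H k) 0 0 = 0) -> u = 0.
  move=> vH.
  apply: (claim (\max_(i < D.+1) size (pt i)) (\max_(i < D.+1) rw (pt i) 0)%N) vH.
  move=> i _; split; first exact: (leq_bigmax i).
  exact: (leq_bigmax (F := fun j => rw (pt j) 0) i).
have base (w : 'rV[rat]_D.+1) : (forall i, w 0 i != 0 -> size (pt i) = 0%N) ->
    (forall a : seq nat, (w *m \prod_(k <- a) H k) 0 0 = 0) -> w = 0.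
  move=> supp wH; apply/rowP => i; rewrite mxE; apply/eqP; apply: contraT => nz.
  have E0 : i = 0 by apply: pt_inj; apply: val_inj; apply: size0nil; apply: supp.
  by move: nz; have := wH [::]; rewrite big_nil mulmx1 E0 => ->; rewrite eqxx.
elim: L m u => [|L IHL] m u.
  by move=> supp; apply: base => i /supp[]; rewrite leqn0 => /eqP.
elim: m u => [|m IHm] u supp uH.
  apply: base uH => i /supp[_]; rewrite leqn0 -(negbK (_ == _)) -lt0n row_gt0.
  by case: (size _).
have step i j : u 0 i != 0 -> H m.+1 i j != 0 ->
    rw (pt i) 0 = m.+1 /\ pt j = part_tail (pt i).
  move=> /supp[_ le]; rewrite mxE; case: andP => // -[st /eqP sz] _.
  exact: strip_full_row st sz le.
have uHm : u *m H m.+1 = 0.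
  apply: (IHL m.+1) => [j|a]; last by rewrite -(uH (m.+1 :: a)) big_cons mulmxA.
  rewrite mxE => nz; have /existsP[i] : [exists i, u 0 i * H m.+1 i j != 0].
    apply: contraR nz => /existsPn H0; apply/eqP/big1 => x _.
    by apply/eqP/negPn/H0.
  rewrite mulf_eq0 => /norP[ui Hi]; have [r0 ->] := step i j ui Hi.
  have [szi _] := supp i ui.
  rewrite row_part_tail -[m.+1]r0 row_leS; split=> //.
  by rewrite leqNgt -row_gt0 row_part_tail row_gt0 -leqNgt.
apply: IHm uH => i ui; have [szi lei] := supp i ui; split=> //.
move: lei; rewrite leq_eqVlt ltnS => /orP[/eqP r0|//].
have [j jE] : exists j, part_tail (pt i) = pt j.
  by apply/ptP/(s_down (pt_in i)) => k; rewrite row_part_tail row_leS.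
(* Among partitions with first row m+1 the tail determines the partition, so entry [j] of the
   product is the single coefficient [u 0 i]. *)
have /rowP/(_ j) := uHm; rewrite !mxE (bigD1 i) //= big1 ?addr0 => [|i' ne].
  rewrite mxE -jE strip_part_tail sumn_part_tail r0 addnC eqxx mulr1 => u0.
  by rewrite u0 eqxx in ui.
apply/eqP; apply: contraR ne; rewrite mulf_eq0 => /norP[ui' Hi'].
have [r0' jE'] := step i' j ui' Hi'; apply/eqP/pt_inj/part_eqP => -[|k].
  by rewrite r0 r0'.
by rewrite -!row_part_tail jE -jE'.
Qed.

(** Over the rationals Newton's identities express each [H n] through the p_k, so words in these
    separate as well. An H-word is converted from the left, the converted letters collecting in
    [rho]; as [p 0] is zero, the index of the remaining [H] drops at each use. *)
Lemma power_mx_separate (v : 'rV[rat]_D.+1) :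
  (forall rho : seq nat, (v *m \prod_(k <- rho) p k) 0 0 = 0) -> v = 0.
Proof.
move=> vp; apply: strip_mx_separate => a.
suff: forall rho, (v *m \prod_(k <- rho) p k *m \prod_(k <- a) H k) 0 0 = 0.
  by move/(_ [::]); rewrite big_nil mulmx1.
elim: a => [|n a IH] rho; first by rewrite big_nil mulmx1 vp.
rewrite big_cons; elim/ltn_ind: n rho => n IHn rho.
case: n IHn => [|n] IHn; first by rewrite strip_mx0 mul1r IH.
have -> : H n.+1 = n.+1%:R^-1 *: \sum_(k < n.+2) p k * H (n.+1 - k).
  by rewrite -strip_mx_newton -scaler_nat scalerA mulVf ?scale1r // pnatr_eq0.
rewrite -scalerAl -scalemxAr mxE mulr_suml mulmx_sumr summxE big1 ?mulr0 // => k _.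
case: (posnP k) => [->|k0]; first by rewrite power_mx0 !mul0r mulmx0 mxE.
have := IHn (n.+1 - k)%N _ (rcons rho k); rewrite -cats1 big_cat big_seq1 => <-; last by lia.
by rewrite -!mulmxE !mulmxA.
Qed.

Lemma power_prod_perm (t u : seq nat) : perm_eq t u ->
  \prod_(k <- t) p k = \prod_(k <- u) p k.
Proof.
apply/catCA_perm_subst: t u => x y z; rewrite !big_cat /= !mulrA; congr (_ * _).
apply: commr_prod => k _; apply: commr_sym; apply: commr_prod => l _.
exact: power_mx_comm.
Qed.

End StripOperators.

(** * Branching of tableaux *)

Section Cells.
Variable la : part.

Lemma col_lt (c : cell la) : (col c < rw la (Defs.row c))%N.
Proof. exact: ltn_ord. Qed.

Lemma cell_ex i j : (j < rw la i)%N ->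
  exists c : cell la, Defs.row c = i /\ col c = j.
Proof.
move=> ji; have il : (i < size la)%N by rewrite -row_gt0; lia.
by exists (Tagged (fun i : 'I_(size la) => 'I_(rw la i)) (i := Ordinal il) (Ordinal ji)).
Qed.

Lemma cell_inj (c d : cell la) :
  Defs.row c = Defs.row d -> col c = col d -> c = d.
Proof.
case: c d => [i j] [i' j']; rewrite /Defs.row /col /= => /val_inj ii.
by case: _ / ii j' => j' /val_inj ->.
Qed.

Lemma sum_cells (F : nat -> nat -> nat) :
  (\sum_(c : cell la) F (Defs.row c) (col c)
   = \sum_(i < size la) \sum_(j < rw la i) F i j)%N.
Proof.
exact/esym/(@sig_big_dep _ _ _ 'I_(size la) (fun i => 'I_(rw la i)) predT
  (fun=> predT) (fun i j => F i j)).
Qed.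

End Cells.

Lemma sum_rows_widen (la : part) L (F : nat -> nat -> nat) : (size la <= L)%N ->
  (\sum_(i < size la) \sum_(j < rw la i) F i j
   = \sum_(i < L) \sum_(j < rw la i) F i j)%N.
Proof.
move=> sL; rewrite (big_ord_widen L (fun i => \sum_(j < rw la i) F i j)%N sL).
rewrite big_mkcond; apply: eq_bigr => i _ /=; case: ltnP => // li.
by rewrite big1 // => -[j jl]; exfalso; move: jl; rewrite nth_default.
Qed.

Lemma count_prefix (P : pred nat) m :
    (forall j j', (j < j' < m)%N -> P j' -> P j) ->
  forall j, (j < m)%N -> P j = (j < count P (iota 0 m))%N.
Proof.
elim: m => [//|m IH] Pd j; rewrite ltnS -[in iota 0 _]addn1 iotaD count_cat /= add0n addn0.
have Pd' : forall j j', (j < j' < m)%N -> P j' -> P j.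
  by move=> x x' xx; apply: Pd; lia.
case: (boolP (P m)) => [Pm|nPm] /= jm; last first.
  rewrite addn0; move: jm; rewrite leq_eqVlt => /orP[/eqP ->|]; last exact: IH.
  rewrite (negPf nPm) ltnNge; apply/esym/negbTE/negPn.
  by rewrite -[X in (_ <= X)%N](size_iota 0) count_size.
have all : all P (iota 0 m).
  by apply/allP => x; rewrite mem_iota => /= xm; apply: Pd Pm; lia.
move: all; rewrite all_count size_iota => /eqP ->; rewrite addn1 ltnS jm.
by move: jm; rewrite leq_eqVlt => /orP[/eqP ->|jm] //; apply: Pd Pm; lia.
Qed.

Lemma card_in_le (T U : finType) (A : {set T}) (B : {set U}) (f : T -> U) :
    {in A, forall x, f x \in B} -> {in A &, injective f} -> (#|A| <= #|B|)%N.
Proof.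
move=> fAB fI; rewrite -(card_in_imset fI); apply: subset_leq_card.
by apply/subsetP => _ /imsetP[x xA ->]; apply: fAB.
Qed.

Lemma card_in_bij (T U : finType) (A : {set T}) (B : {set U})
    (f : T -> U) (g : U -> T) :
    {in A, forall x, f x \in B} -> {in B, forall x, g x \in A} ->
    {in A, cancel f g} -> {in B, cancel g f} -> #|A| = #|B|.
Proof.
move=> fAB gBA fK gK; apply/eqP; rewrite eqn_leq.
by rewrite (card_in_le fAB (can_in_inj fK)) (card_in_le gBA (can_in_inj gK)).
Qed.

(** The letters in [u] are the unprimed ones: [predT] gives semistandard tableaux, the letters below
    k give hook tableaux, so that branching is proved once for both. *)
Definition hook_tab (u : pred nat) (M : nat) (la : part) (T : filling la M) : bool :=
  [forall c, forall d,
    [&& left_of c d || above c d ==> (T c <= T d)%N,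
        left_of c d && (T c == T d) ==> u (T c)
      & above c d && (T c == T d) ==> ~~ u (T c)]].

Lemma ssytE M la (T : filling la M) : ssyt T = hook_tab predT T.
Proof.
apply: eq_forallb => c; apply: eq_forallb => d; rewrite !implybT !implybF /=.
case: (left_of c d); case: (above c d) => //=; rewrite ?andbT ?andTb //.
- by rewrite -val_eqE /=; case: ltngtP.
- by rewrite -val_eqE /=; case: ltngtP.
Qed.

Section Tableaux.
Variables (M' : nat) (u : pred nat) (a : nat -> nat).
Local Notation M := M'.+1.

(** Row and column numbers replace dependent cells, so that fillings of two shapes can be compared.
    Outside the shape the value is [M], which is no letter. *)
Definition entry la (T : filling la M) (i j : nat) : nat :=
  if [pick c : cell la | (Defs.row c == i) && (col c == j)] is Some c then T c else M.

Definition fill la (f : nat -> nat -> nat) : filling la M :=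
  [ffun c => inord (f (Defs.row c) (col c))].

Lemma entryE la (T : filling la M) c : entry T (Defs.row c) (col c) = T c.
Proof.
rewrite /entry; case: pickP => [d /andP[/eqP r /eqP k]|/(_ c)]; last by rewrite !eqxx.
by rewrite (cell_inj r k).
Qed.

Lemma entry_fill la f i j : (j < rw la i)%N -> (f i j < M)%N ->
  entry (fill la f) i j = f i j.
Proof.
by move=> /cell_ex[c [<- <-]] fM; rewrite entryE ffunE inordK.
Qed.

Lemma fill_entry la (T : filling la M) f :
  (forall i j, (j < rw la i)%N -> f i j = entry T i j) -> fill la f = T.
Proof.
move=> fT; apply/ffunP => c; apply: val_inj.
by rewrite ffunE fT ?col_lt // entryE inord_val.
Qed.

Definition tab_rule (la : part) (f : nat -> nat -> nat) : Prop :=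
  (forall i j j', (j < j')%N -> (j' < rw la i)%N ->
     (f i j <= f i j')%N /\ (f i j = f i j' -> u (f i j)))
  /\ (forall i i' j, (i < i')%N -> (j < rw la i')%N ->
     (f i j <= f i' j)%N /\ (f i j = f i' j -> ~~ u (f i j))).

Lemma hook_tabP la (T : filling la M) : reflect (tab_rule la (entry T)) (hook_tab u T).
Proof.
apply: (iffP forallP) => [H|[Hr Hc] c].
  split=> [i j j' jj ji|i i' j ii ji].
    have [c [ci cj]] := cell_ex (ltn_trans jj ji); have [d [di dj]] := cell_ex ji.
    have -> : entry T i j = T c by rewrite -ci -cj entryE.
    have -> : entry T i j' = T d by rewrite -di -dj entryE.
    have /forallP/(_ d) := H c; rewrite /left_of /above ci cj di dj eqxx jj /=.
    by move=> /and3P[-> /implyP h _]; split=> // /val_inj/eqP.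
  have [c [ci cj]] := cell_ex (leq_trans ji (row_le _ (ltnW ii))).
  have [d [di dj]] := cell_ex ji.
  have -> : entry T i j = T c by rewrite -ci -cj entryE.
  have -> : entry T i' j = T d by rewrite -di -dj entryE.
  have /forallP/(_ d) := H c; rewrite /left_of /above ci cj di dj eqxx ii orbT /=.
  by move=> /and3P[-> _ /implyP h]; split=> // /val_inj/eqP.
apply/forallP => d; rewrite -val_eqE /= -!entryE /left_of /above.
apply/and3P; split; apply/implyP.
- by case/orP => /andP[/eqP E lt]; [rewrite E; apply Hr => //; exact: col_lt
    | rewrite E; apply Hc => //; exact: col_lt].
- move=> /andP[/andP[/eqP E lt] /eqP]; rewrite E.
  by apply Hr => //; exact: col_lt.
- move=> /andP[/andP[/eqP E lt] /eqP]; rewrite E.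
  by apply Hc => //; exact: col_lt.
Qed.

Lemma tab_rule_ext la f g : (forall i j, (j < rw la i)%N -> f i j = g i j) ->
  tab_rule la f -> tab_rule la g.
Proof.
move=> fg [Hr Hc]; split=> [i j j' jj ji|i i' j ii ji].
  by rewrite -!fg //; [apply: Hr | exact: ltn_trans ji].
by rewrite -!fg //; [apply: Hc | exact: leq_trans ji (row_le _ (ltnW ii))].
Qed.

Lemma tab_rule_sub la mu f : (forall i, (rw mu i <= rw la i)%N) ->
  tab_rule la f -> tab_rule mu f.
Proof.
move=> sub [Hr Hc]; split=> [i j j' jj ji|i i' j ii ji].
  by apply: Hr => //; exact: leq_trans (sub _).
by apply: Hc => //; exact: leq_trans (sub _).
Qed.

Definition content la (T : filling la M) (x : nat) : nat :=
  #|[set c | T c == x :> nat]|.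

Lemma contentE la (T : filling la M) x L : (size la <= L)%N ->
  content T x = (\sum_(i < L) \sum_(j < rw la i) (entry T i j == x))%N.
Proof.
move=> sL; rewrite /content -sum1_card.
rewrite -(sum_rows_widen (fun i j => nat_of_bool (entry T i j == x)) sL).
rewrite -(sum_cells la (fun i j => nat_of_bool (entry T i j == x))) big_mkcond.
by apply: eq_bigr => c _; rewrite inE entryE; case: eqP.
Qed.

(* The codomain ['I_M] of the fillings stays fixed while [N] decreases, so that
   removing the largest letter does not change the alphabet. *)
Definition tabs (N : nat) (la : part) : {set filling la M} :=
  [set T | [&& hook_tab u T, [forall c, T c < N]%N
             & [forall x : 'I_N, content T x == a x]]].

Lemma tabsP N la (T : filling la M) : reflect
  [/\ tab_rule la (entry T), forall i j, (j < rw la i)%N -> (entry T i j < N)%N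
    & forall x, (x < N)%N -> content T x = a x] (T \in tabs N la).
Proof.
rewrite inE; apply: (iffP and3P) => -[/hook_tabP h1 h2 h3].
  split=> // [i j /cell_ex[c [<- <-]]|x xN]; first by rewrite entryE; apply/forallP: c.
  by have /forallP/(_ (Ordinal xN))/eqP := h3.
split=> //; first by apply/forallP => c; rewrite -entryE; apply/h2/col_lt.
by apply/forallP => x; rewrite h3.
Qed.

(** In a tableau the cells with letters below [N] start each row, so counting them row by row gives
    their shape. *)
Definition shape_below (N : nat) la (T : filling la M) : part :=
  mkpart (fun i => count (fun j => entry T i j < N)%N (iota 0 (rw la i))) (size la).

Section ShapeBelow.
Variables (N : nat) (la : part) (T : filling la M).
Hypothesis tabT : tab_rule la (entry T).

Let prefix i j : (j < rw la i)%N ->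
  (entry T i j < N)%N = (j < count (fun j => entry T i j < N)%N (iota 0 (rw la i)))%N.
Proof.
move=> jl; rewrite -(count_prefix (P := fun j => entry T i j < N)%N) // => x x' /andP[xx xl].
by have [le _] := tabT.1 i x x' xx xl; apply: leq_ltn_trans.
Qed.

Lemma row_shape_below i : rw (shape_below N T) i
  = count (fun j => entry T i j < N)%N (iota 0 (rw la i)).
Proof.
apply: row_mkpart => [{}i|]; last by rewrite nth_default.
rewrite leqNgt; apply/negP => lt.
set j := count _ _ in lt.
have jl : (j < rw la i.+1)%N.
  by apply: leq_trans lt _; rewrite -[X in (_ <= X)%N](size_iota 0) count_size.
have jl' := leq_trans jl (row_leS la i).
have [le _] := tabT.2 i i.+1 j (ltnSn i) jl.
move: lt; rewrite -prefix // => lt; have := leq_ltn_trans le lt.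
by rewrite prefix // ltnn.
Qed.

Lemma shape_below_sub i : (rw (shape_below N T) i <= rw la i)%N.
Proof. by rewrite row_shape_below -[X in (_ <= X)%N](size_iota 0) count_size. Qed.

Lemma shape_belowE i j : (j < rw la i)%N ->
  (entry T i j < N)%N = (j < rw (shape_below N T) i)%N.
Proof. by rewrite row_shape_below; apply: prefix. Qed.

Lemma shape_below_unique (mu : part) : (forall i, (rw mu i <= rw la i)%N) ->
    (forall i j, (j < rw la i)%N -> (entry T i j < N)%N = (j < rw mu i)%N) ->
  shape_below N T = mu.
Proof.
move=> le H; apply: part_eqP => i; have le' := shape_below_sub i; have lei := le i.
apply/eqP; rewrite eqn_leq; apply/andP; split; rewrite leqNgt; apply/negP => lt.
  by have jl := leq_trans lt le'; move: lt; rewrite -shape_belowE // H // ltnn.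
by have jl := leq_trans lt lei; move: lt; rewrite -H // shape_belowE // ltnn.
Qed.

End ShapeBelow.

Lemma sum_lt_widen (m k : nat) (F : nat -> nat) : (k <= m)%N ->
  (forall j, (k <= j < m)%N -> F j = 0%N) -> (\sum_(j < m) F j = \sum_(j < k) F j)%N.
Proof.
move=> km F0; rewrite (big_ord_widen m F km) [RHS]big_mkcond.
by apply: eq_bigr => j _ /=; case: ltnP => // kj; rewrite F0 // kj ltn_ord.
Qed.

Lemma content_below N la mu (T : filling la M) (T' : filling mu M) x :
    (forall i, (rw mu i <= rw la i)%N) ->
    (forall i j, (j < rw mu i)%N -> entry T' i j = entry T i j) ->
    (forall i j, (j < rw la i)%N -> (entry T i j < N)%N = (j < rw mu i)%N) ->
  (x < N)%N -> content T' x = content T x.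
Proof.
move=> sub eT shp xN; rewrite (contentE T' x (size_le_sub sub)) (contentE T x (leqnn _)).
apply: eq_bigr => i _; rewrite (sum_lt_widen (m := rw la i) (k := rw mu i)
   (F := fun j => nat_of_bool (entry T i j == x))) ?sub //.
  by apply: eq_bigr => j _; rewrite eT.
move=> j /andP[mj jl]; case: eqP => // E.
by have := shp i j jl; rewrite E xN ltnNge mj.
Qed.

Lemma content_top N la mu (T : filling la M) : (forall i, (rw mu i <= rw la i)%N) ->
    (forall i j, (j < rw la i)%N -> (entry T i j < N)%N = (j < rw mu i)%N) ->
    (forall i j, (j < rw la i)%N -> (entry T i j < N.+1)%N) ->
  (content T N + sumn mu = sumn la)%N.
Proof.
move=> sub shp top; rewrite (contentE T N (leqnn _)) (sumn_rows (size_le_sub sub)).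
rewrite (@sumn_rows la (size la)) // -big_split; apply: eq_bigr => i _ /=.
have -> : rw mu i = (\sum_(j < rw la i) (j < rw mu i))%N.
  rewrite (sum_lt_widen (F := fun j => nat_of_bool (j < rw mu i)%N) (sub i)).
    rewrite (eq_bigr (fun=> 1%N)) ?sum_nat_const ?card_ord ?muln1 // => j _.
    by rewrite ltn_ord.
  by move=> j /andP[+ _]; rewrite leqNgt => /negPf ->.
rewrite -big_split -[RHS]card_ord -[RHS]sum1_card; apply: eq_bigr => j _ /=.
by rewrite -shp //; have := top i j (ltn_ord j); case: ltngtP => //; lia.
Qed.

Definition extend_row N (mu : part) (T : filling mu M) (i j : nat) : nat :=
  if (j < rw mu i)%N then entry T i j else N.

Section Extend.
Variables (N : nat) (la mu : part).
Hypotheses (N_lt : (N < M)%N) (lamu : strip (u N) la mu).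
Hypothesis (size_eq : sumn la = (sumn mu + a N)%N).

Let sub i : (rw mu i <= rw la i)%N. Proof. exact: strip_sub lamu. Qed.

Lemma extend_tabs T : T \in tabs N mu ->
  fill la (extend_row N T) \in tabs N.+1 la
  /\ shape_below N (fill la (extend_row N T)) = mu.
Proof.
move=> /tabsP[[Hr Hc] ltN cont].
have leN i j : (extend_row N T i j <= N)%N.
  by rewrite /extend_row; case: ifP => // /ltN/ltnW.
have eqf i j : (j < rw la i)%N -> extend_row N T i j = entry (fill la (extend_row N T)) i j.
  by move=> jl; rewrite entry_fill //; apply: leq_ltn_trans (leN _ _) N_lt.
have rule : tab_rule la (entry (fill la (extend_row N T))).
  apply: tab_rule_ext eqf _; have /stripP st := lamu.
  split=> [i j j' jj ji|i i' j ii ji]; rewrite /extend_row.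
    case: (ltnP j' (rw mu i)) => j'm; first by rewrite (ltn_trans jj j'm); apply: Hr.
    case: (ltnP j (rw mu i)) => jm.
      by have lt := ltN i j jm; split=> [|E]; [exact: ltnW | move: lt; rewrite E ltnn].
    split=> // _; have [_] := st i; case: (u N) => //; lia.
  have mii := row_le mu (ltnW ii).
  case: (ltnP j (rw mu i')) => j'm; first by rewrite (leq_trans j'm mii); apply: Hc.
  case: (ltnP j (rw mu i)) => jm.
    by have lt := ltN i j jm; split=> [|E]; [exact: ltnW | move: lt; rewrite E ltnn].
  split=> // _; have [_] := st i; case: (u N) => // le.
  by have := row_le la ii; lia.
have shp i j : (j < rw la i)%N ->
    (entry (fill la (extend_row N T)) i j < N)%N = (j < rw mu i)%N.
  move=> jl; rewrite -eqf // /extend_row.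
  by case: ifP => [/ltN ->|]; rewrite ?ltnn.
have leN' i j : (j < rw la i)%N -> (entry (fill la (extend_row N T)) i j < N.+1)%N.
  by move=> jl; rewrite -eqf // ltnS.
split; last exact: shape_below_unique.
apply/tabsP; split=> // x; rewrite ltnS leq_eqVlt => /orP[/eqP ->|xN].
  have := content_top sub shp leN'; lia.
rewrite -(content_below (T' := T) sub _ shp xN) ?cont // => i j jm.
by rewrite -eqf ?(leq_trans jm) // /extend_row jm.
Qed.

End Extend.

Section Restrict.
Variables (N : nat) (la : part) (T : filling la M).
Hypothesis (Ttab : T \in tabs N.+1 la).
Local Notation mu := (shape_below N T).

Lemma shape_below_strip : strip (u N) la mu /\ sumn la = (sumn mu + a N)%N.
Proof.
have /tabsP[rule leN cont] := Ttab; have sub i := shape_below_sub N rule i.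
split; last first.
  have := content_top sub (fun i j => @shape_belowE N la T rule i j) leN.
  by rewrite cont // addnC => ->.
have atN i j : (j < rw la i)%N -> (rw mu i <= j)%N -> entry T i j = N.
  move=> jl mj; apply/eqP; rewrite eqn_leq -ltnS leN //= leqNgt shape_belowE //.
  by rewrite -leqNgt.
(* A failure in row i would place [N] in two cells of one column if [N] is unprimed, or of one row
   if it is primed. *)
apply/stripP => i; split=> //; case: ifP => uN; rewrite leqNgt; apply/negP => lt.
  have lt' := leq_trans lt (row_leS la i).
  have [_] := rule.2 i i.+1 (rw mu i) (ltnSn i) lt.
  rewrite !atN ?uN //; first by move=> /(_ erefl).
  have := sub i.+1; have := row_leS mu i; lia.
have [_] := rule.1 i (rw mu i) (rw mu i).+1 (ltnSn _) lt.
by rewrite !atN ?uN //; [move=> /(_ erefl) | exact: ltnW].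
Qed.

Lemma restrict_tabs : fill mu (entry T) \in tabs N mu.
Proof.
have /tabsP[rule leN cont] := Ttab; have sub i := shape_below_sub N rule i.
have lt i j : (j < rw mu i)%N -> (entry T i j < N)%N.
  by move=> jm; rewrite shape_belowE // (leq_trans jm).
have ltM i j : (j < rw la i)%N -> (entry T i j < M)%N.
  by move=> /cell_ex[c [<- <-]]; rewrite entryE.
have eqf i j : (j < rw mu i)%N -> entry T i j = entry (fill mu (entry T)) i j.
  by move=> jm; rewrite entry_fill // ltM // (leq_trans jm).
apply/tabsP; split=> [|i j jm|x xN].
- by apply: tab_rule_ext eqf _; apply: tab_rule_sub rule.
- by rewrite -eqf ?lt.
rewrite (content_below (T := T) sub _ _ xN) ?cont ?leqW // => i j jm.
  by rewrite -eqf.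
exact: shape_belowE.
Qed.

End Restrict.

Lemma card_tabs0 la : #|tabs 0 la| = (la == part0).
Proof.
case: (eqVneq la part0) => [->|ne].
  apply/eqP/cards1P; exists (fill part0 (fun _ _ => 0%N)).
  apply/setP => T; rewrite inE; have nocell (c : cell part0) : False by case: c => -[].
  have -> : T = fill part0 (fun _ _ => 0%N) by apply/ffunP => c; case: (nocell c).
  apply/tabsP/eqP => // _; split=> // [|i j]; last by rewrite nth_nil.
  by split=> [i j j'|i i' j]; rewrite nth_nil.
apply: eq_card0 => T; apply/negP => /tabsP[_ H _].
have /H : (0 < rw la 0)%N by rewrite row_gt0 lt0n size_eq0.
by [].
Qed.

(** Tableaux are sorted by the shape of their letters below [N]; for each shape, deleting the letter
    [N] and filling the strip with it are inverse bijections. *)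
Lemma card_tabsS (s : seq part) N la : uniq s -> (N < M)%N ->
    (forall mu : part, (forall i, (rw mu i <= rw la i)%N) -> mu \in s) ->
  #|tabs N.+1 la| = (\sum_(mu <- s | strip (u N) la mu
      && (sumn la == sumn mu + a N)) #|tabs N mu|)%N.
Proof.
move=> us NM sub.
transitivity (\sum_(mu <- s) #|[set T in tabs N.+1 la | shape_below N T == mu]|)%N.
  rewrite -sum1_card; under [RHS]eq_bigr => mu _ do rewrite -sum1_card big_mkcond.
  rewrite exchange_big [LHS]big_mkcond; apply: eq_bigr => T _ /=.
  case: (boolP (T \in _)) => [TA|nTA]; last first.
    by rewrite big1 // => mu _; rewrite inE (negPf nTA).
  have shs : shape_below N T \in s.
    by apply: sub => i; apply: shape_below_sub; case/tabsP: TA.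
  rewrite (bigD1_seq _ shs us) /= inE TA eqxx big1 // => mu ne.
  by rewrite inE TA eq_sym (negPf ne).
rewrite [RHS]big_mkcond; apply: eq_bigr => mu _; case: ifP => [/andP[st /eqP sz]|nst].
  apply: (card_in_bij (f := fun T => fill mu (entry T))
     (g := fun T => fill la (extend_row N T))).
  - by move=> T; rewrite inE => /andP[TA /eqP <-]; apply: restrict_tabs.
  - move=> T TA; have [h1 h2] := extend_tabs NM st sz TA.
    by rewrite inE h1 h2 eqxx.
  - move=> T; rewrite inE => /andP[/[dup] TA /tabsP[rule leN _] /eqP E].
    apply: fill_entry => i j jl; rewrite /extend_row -{1}E -shape_belowE //.
    case: ltnP => [lt|ge]; last by apply/eqP; rewrite eqn_leq ge -ltnS leN.
    rewrite entry_fill //; last exact: leq_trans lt (ltnW _).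
    by rewrite -E -shape_belowE.
  move=> T TA; have /tabsP[_ leN _] := TA; apply: fill_entry => i j jm.
  rewrite entry_fill /extend_row ?jm //; last exact: ltn_trans (leN _ _ jm) NM.
  by apply: leq_trans jm (strip_sub i st).
apply: eq_card0 => T; rewrite inE; apply/negP => /andP[TA /eqP E].
by have [] := shape_below_strip TA; rewrite E => st sz; rewrite st sz eqxx in nst.
Qed.

End Tableaux.
Arguments tabs : clear implicits.

(** * Words of strip operators and dimension count *)

Definition tab_gen (u : pred nat) (M : nat) (la : part) : {mpoly rat[M]} :=
  \sum_(T : filling la M | hook_tab u T) weight T.

Lemma schurE M la : schur M la = tab_gen predT M la.
Proof. by apply: eq_bigl => T; apply: ssytE. Qed.

(** The empty alphabet is treated apart, since branching works with [M'.+1] letters; a filling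
    without letters has no cell to test. *)
Lemma tab_gen0 u u' la : tab_gen u 0 la = tab_gen u' 0 la.
Proof.
by apply: eq_bigl => T; apply: eq_forallb => c; have := ltn_ord (T c).
Qed.

Lemma mcoeff_tab_gen M' u la (m : 'X_{1..M'.+1}) :
  (tab_gen u M'.+1 la)@_m = #|tabs M' u (fun x => m (inord x)) M'.+1 la|%:R.
Proof.
rewrite /tab_gen raddf_sum /= -sum1_card natr_sum big_mkcond [RHS]big_mkcond /=.
apply: eq_bigr => T _.
have -> : weight T = 'X_[ [multinom #|[set c | T c == j]| | j < M'.+1] ].
  by rewrite mpolyXE_id; apply: eq_bigr => j _; rewrite mnmE.
rewrite mcoeffX inE; case: (hook_tab u T) => //=.
have -> : [forall c, T c < M'.+1]%N by apply/forallP => c.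
rewrite /=; case: eqP => [<-|ne]; case: forallP => // H; exfalso.
  by apply: H => x; rewrite inord_val mnmE.
by apply: ne; apply/mnmP => x; have := H x; rewrite inord_val mnmE => /eqP.
Qed.

Section Words.
Variable r : seq part.
Local Notation s := (part0 :: r).
Hypothesis s_uniq : uniq s.
Hypothesis s_down : forall la mu : part,
  la \in s -> (forall i, (rw mu i <= rw la i)%N) -> mu \in s.
Local Notation D := (size r).
Local Notation pt := (@pt r).

(** The largest letter is peeled off first and stands leftmost in the product. *)
Fixpoint word_mx (u : pred nat) (a : nat -> nat) (N : nat) : 'M[rat]_D.+1 :=
  if N is N'.+1 then strip_mx r (u N') (a N') * word_mx u a N' else 1.

Lemma card_tabs_word M' u a N (i : 'I_D.+1) : (N <= M'.+1)%N ->
  #|tabs M' u a N (pt i)|%:R = word_mx u a N i 0.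
Proof.
elim: N i => [|N IH] i NM.
  by rewrite card_tabs0 mxE -(pt0 r) (inj_eq (pt_inj s_uniq)).
rewrite (card_tabsS u a s_uniq) => [||mu]; [|exact: NM|exact/s_down/pt_in].
rewrite natr_sum big_mkcond -(sum_pt r) mxE; apply: eq_bigr => j _.
by rewrite mxE -IH ?(ltnW NM) //; case: (_ && _); rewrite ?mul1r ?mul0r.
Qed.

Lemma word_mx_all a N (u : pred nat) : (forall x, (x < N)%N -> u x) ->
  word_mx u a N = \prod_(k <- rev (mkseq a N)) strip_mx r true k.
Proof.
elim: N => [|N IH] uN; first by rewrite big_nil.
rewrite /= /mkseq -[in iota 0 _]addn1 iotaD map_cat rev_cat /= big_cons -IH => [|x xN].
  by rewrite uN.
by apply: uN; apply: ltnW.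
Qed.

(** Letters are replaced one at a time from the largest; the hypothesis passes from [v] to its image
    under a horizontal operator because the latter commutes with both families. *)
Lemma word_mx_eq (v : 'rV[rat]_D.+1) a u N :
  (forall k, v *m strip_mx r true k = v *m strip_mx r false k) ->
  v *m word_mx u a N = v *m word_mx predT a N.
Proof.
elim: N v => [//|N IH] v HE /=; rewrite -!mulmxE !mulmxA.
have -> : v *m strip_mx r (u N) (a N) = v *m strip_mx r true (a N).
  by case: (u N).
apply: IH => k; rewrite -!mulmxA.
have := strip_mx_comm s_uniq s_down (a N) k; rewrite /GRing.comm -!mulmxE => ->.
have CE : strip_mx r true (a N) *m strip_mx r false k
        = strip_mx r false k *m strip_mx r true (a N).
  rewrite col_mxE -scalemxAl -scalemxAr; congr (_ *: _).
  exact: strip_mx_comm_col.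
by rewrite CE !mulmxA HE.
Qed.

Lemma row_eq_col_words (v : 'rV[rat]_D.+1) :
  (forall k, v *m strip_mx r true k = v *m strip_mx r false k)
  <-> (forall k l a, (v *m word_mx predT a (k + l)) 0 0
         = (v *m word_mx (fun x => x < k)%N a (k + l)) 0 0).
Proof.
split=> [HE k l a|H e]; first by rewrite word_mx_eq // [in RHS]word_mx_eq.
apply/eqP; rewrite -subr_eq0 -mulmxBr; apply/eqP.
apply: (strip_mx_separate s_uniq s_down) => t.
(* Content for [size t] unprimed letters and one primed letter on top: the top letter, of
   multiplicity [e], acts first, then the others from the largest down, which is why [t] is
   reversed. *)
pose a x := if (x < size t)%N then nth 0%N (rev t) x else e.
have := H (size t) 1%N a; rewrite addn1 /= ltnn.
rewrite (_ : a (size t) = e); last by rewrite /a ltnn.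
have wt (u : pred nat) : (forall x, (x < size t)%N -> u x) ->
    word_mx u a (size t) = \prod_(k <- t) strip_mx r true k.
  move=> uN; rewrite word_mx_all //; congr (\big[_/_]_(_ <- _) _).
  rewrite -[RHS]revK; congr rev; rewrite -[RHS](mkseq_nth 0%N) size_rev.
  by apply/eq_in_map => x; rewrite mem_iota /a => /= ->.
rewrite !wt // -!mulmxE !mulmxA => E.
have mxB (A B : 'rV[rat]_D.+1) : (A - B) 0 0 = A 0 0 - B 0 0 by rewrite !mxE.
by rewrite mulmxBr mulmxBl mxB E subrr.
Qed.

End Words.

(** * Coordinates in the Schur basis *)

Section Coordinates.
Variable r : seq part.
Local Notation s := (part0 :: r).
Hypothesis s_uniq : uniq s.
Local Notation D := (size r).
Local Notation pt := (@pt r).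

Definition coords (f : symfun) : 'rV[rat]_D.+1 := \row_i monalg.mcoeff (pt i) f.

Definition of_coords (v : 'rV[rat]_D.+1) : symfun :=
  \sum_i v 0 i *: monalg.mkmalgU (pt i) 1.

Lemma mcoeff_of_coords v la :
  monalg.mcoeff la (of_coords v) = \sum_i v 0 i * (pt i == la)%:R.
Proof.
rewrite raddf_sum; apply: eq_bigr => i _ /=.
by rewrite monalg.mcoeffZ monalg.mcoeffU.
Qed.

Lemma coordsK v : coords (of_coords v) = v.
Proof.
apply/rowP => j; rewrite mxE mcoeff_of_coords (bigD1 j) //= eqxx mulr1.
by rewrite big1 ?addr0 // => i ne; rewrite (inj_eq (pt_inj s_uniq)) (negPf ne) mulr0.
Qed.

Lemma of_coordsK f : {subset monalg.msupp f <= s} -> of_coords (coords f) = f.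
Proof.
move=> sub; apply/monalg.malgP => la; case: (boolP (la \in s)) => [/ptP[j ->]|las].
  by have /rowP/(_ j) := coordsK (coords f); rewrite !mxE.
rewrite mcoeff_of_coords big1 => [|i _].
  by rewrite monalg.mcoeff_outdom //; apply: contra las => /sub.
by case: eqP => [E|_]; [rewrite -E pt_in in las | rewrite mulr0].
Qed.

Lemma of_coords_sum d (c : 'I_d -> rat) (v : 'I_d -> 'rV[rat]_D.+1) :
  of_coords (\sum_(x < d) c x *: v x) = \sum_(x < d) c x *: of_coords (v x).
Proof.
rewrite /of_coords; under [RHS]eq_bigr => x _ do rewrite scaler_sumr.
rewrite exchange_big; apply: eq_bigr => i _ /=.
rewrite summxE scaler_suml; apply: eq_bigr => x _.
by rewrite mxE scalerA.
Qed.

Lemma sum_coords (V : lmodType rat) (f : symfun) (F : part -> V) :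
  {subset monalg.msupp f <= s} ->
  \sum_(la <- monalg.msupp f) monalg.mcoeff la f *: F la
  = \sum_i coords f 0 i *: F (pt i).
Proof.
move=> sub; under [RHS]eq_bigr => i _ do rewrite mxE.
rewrite (sum_pt r (fun la => monalg.mcoeff la f *: F la)).
rewrite [RHS](bigID (mem (monalg.msupp f))) /=.
rewrite [X in _ + X]big1 ?addr0 => [|la nla]; last first.
  by rewrite monalg.mcoeff_outdom ?scale0r.
rewrite -[RHS]big_filter; apply: perm_big; apply: uniq_perm.
- exact: fset_uniq.
- by rewrite filter_uniq.
- by move=> la; rewrite mem_filter; case: (boolP (la \in _)) => // /sub ->.
Qed.

Hypothesis s_down : forall la mu : part,
  la \in s -> (forall i, (rw mu i <= rw la i)%N) -> mu \in s.

Lemma doubly_symmetric_words f : {subset monalg.msupp f <= s} ->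
  doubly_symmetric f
  <-> (forall k l a, (coords f *m word_mx r predT a (k + l)) 0 0
         = (coords f *m word_mx r (fun x => x < k)%N a (k + l)) 0 0).
Proof.
move=> sub.
have wordE M' (m : 'X_{1..M'.+1}) u : (\sum_i coords f 0 i *: tab_gen u M'.+1 (pt i))@_m
   = (coords f *m word_mx r u (fun x => m (inord x)) M'.+1) 0 0.
  rewrite raddf_sum [RHS]mxE; apply: eq_bigr => i _ /=.
  by rewrite mcoeffZ mcoeff_tab_gen card_tabs_word.
have dsE k l : (\sum_(la <- monalg.msupp f) monalg.mcoeff la f *: schur (k + l) la
    = \sum_(la <- monalg.msupp f) monalg.mcoeff la f *: hook_schur k l la)
  <-> (\sum_i coords f 0 i *: tab_gen predT (k + l) (pt i)
    = \sum_i coords f 0 i *: tab_gen (fun x => x < k)%N (k + l) (pt i)).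
  rewrite !sum_coords //; under eq_bigr do rewrite schurE.
  by [].
split=> [ds k l a|H k l]; last first.
  apply/dsE; move: (H k l); move: (k + l)%N => [|M'] Hkl.
    by apply: eq_bigr => i _; congr (_ *: _); apply: tab_gen0.
  by apply/mpolyP => m; rewrite !wordE.
have /dsE := ds k l; case: (k + l)%N => [//|M'] E.
(* A monomial records [a] only on the letters of the alphabet; the word matrix reads nothing
   else. *)
have wa u N : (N <= M'.+1)%N -> word_mx r u a N
    = word_mx r u (fun x => [multinom a i | i < M'.+1] (inord x)) N.
  elim: N => [//|N IH] NM /=.
  by rewrite -IH ?mnmE ?inordK // ltnW.
by rewrite !wa // -!wordE E.
Qed.

End Coordinates.

(** * Partitions of size at most n and the power sum table *)

Definition parts_of (n : nat) : seq part :=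
  pmap insub (bounded_parts (n + n).+1 n n).

Lemma mem_parts_of n (la : part) : (la \in parts_of n) = (sumn la == n).
Proof.
rewrite mem_pmap_sub mem_bounded_parts // part_neq0 /=.
case: eqP => [<-|]; rewrite ?andbF ?andbT //.
case: la => -[|x t] //= /andP[/= p _].
by rewrite p leq_addr.
Qed.

Lemma uniq_parts_of n : uniq (parts_of n).
Proof. by apply: pmap_sub_uniq; apply: uniq_bounded_parts. Qed.

Lemma count_parts_of n : count (fun la : part => all odd la) (parts_of n) = odd_count n n.
Proof.
rewrite -(count_map val (all odd)) /parts_of pmap_filter; last exact: insubK.
rewrite (_ : [seq x <- _ | _] = bounded_parts (n + n).+1 n n) //.
apply/all_filterP/allP => t; rewrite mem_bounded_parts // => /and3P[p n0 _].
by rewrite isSome_insub /is_part n0 (path_sorted p).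
Qed.

Definition parts_upto (n : nat) : seq part :=
  [seq la <- undup (flatten [seq parts_of k | k <- iota 0 n.+1]) | la != part0].

Section UptoN.
Variable n : nat.
Local Notation r := (parts_upto n).
Local Notation s := (part0 :: r).

Lemma mem_parts_upto (la : part) : (la \in s) = (sumn la <= n)%N.
Proof.
rewrite in_cons mem_filter mem_undup.
case: (eqVneq la part0) => [-> //|_]; rewrite orFb andTb.
apply/flattenP/idP => [[t /mapP[k + ->]]|le].
  by rewrite mem_iota mem_parts_of /= add0n ltnS => kn /eqP ->.
exists (parts_of (sumn la)); last by rewrite mem_parts_of.
by apply: map_f; rewrite mem_iota /= add0n ltnS.
Qed.

Lemma uniq_parts_upto : uniq s.
Proof. by rewrite /= filter_uniq ?undup_uniq // mem_filter eqxx. Qed.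

Lemma parts_upto_down (la mu : part) :
  la \in s -> (forall i, (rw mu i <= rw la i)%N) -> mu \in s.
Proof.
by rewrite !mem_parts_upto => le /sumn_le_sub; move/leq_trans; apply.
Qed.

Local Notation D := (size r).
Local Notation pt := (@pt r).
Local Notation p := (power_mx r).

Definition odd_indices : {set 'I_D.+1} :=
  [set j | all odd (pt j) && (sumn (pt j) == n)].

Lemma card_odd_indices : #|odd_indices| = odd_count n n.
Proof.
rewrite -count_parts_of -sum1_card big_mkcond.
under eq_bigr => j _ do rewrite inE.
rewrite (sum_pt r (fun la : part => if all odd la && (sumn la == n) then 1 else 0)%N).
rewrite -big_mkcond sum1_count -!size_filter; apply/perm_size/uniq_perm.
- by rewrite filter_uniq ?uniq_parts_upto.
- by rewrite filter_uniq ?uniq_parts_of.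
move=> la; rewrite !mem_filter mem_parts_of mem_parts_upto.
by case: eqP => [->|_]; rewrite ?leqnn ?andbT ?andbF.
Qed.

Definition power_prod (rho : seq nat) : 'M[rat]_D.+1 := \prod_(k <- rho) p k.

(** Entry (i, j) is <p_rho, S_lambda> with rho = [pt j] and lambda = [pt i]: a character value of a
    symmetric group, or 0 if the sizes differ. *)
Definition power_table : 'M[rat]_D.+1 :=
  \matrix_(i, j) power_prod (pt j) i 0.

Lemma power_tableE (v : 'rV[rat]_D.+1) j :
  (v *m power_table) 0 j = (v *m power_prod (pt j)) 0 0.
Proof. by rewrite !mxE; apply: eq_bigr => i _; rewrite mxE. Qed.

Lemma power_table_graded i j : power_table i j != 0 -> sumn (pt i) = sumn (pt j).
Proof. by rewrite mxE => /(graded_power_prod uniq_parts_upto) ->. Qed.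

(** A word containing 0 vanishes because [p 0] does, and one of size above [n] because it lowers the
    degree too far; any other can be sorted into a partition, as the p_k commute. *)
Lemma power_prod_normal (v : 'rV[rat]_D.+1) (rho : seq nat) :
  (v *m power_prod rho) 0 0 = 0
  \/ exists j, perm_eq (pt j) rho
       /\ (v *m power_prod rho) 0 0 = (v *m power_table) 0 j.
Proof.
have perm := power_prod_perm uniq_parts_upto parts_upto_down.
case: (boolP (0%N \in rho)) => [rho0|nrho0].
  left; rewrite /power_prod (perm _ _ (perm_to_rem rho0)) big_cons power_mx0.
  by rewrite mul0r mulmx0 mxE.
have sP : is_part (sort geq rho).
  rewrite /is_part mem_sort nrho0 andbT; apply: sort_sorted => x y.
  exact: leq_total.
case: (leqP (sumn rho) n) => le; [right | left].
  have pe : perm_eq (Part sP) rho by exact: permEl (perm_sort geq rho).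
  have /ptP[j jE] : Part sP \in s by rewrite mem_parts_upto (perm_sumn pe).
  by exists j; rewrite power_tableE -jE /power_prod (perm _ _ pe).
rewrite mxE big1 // => i _; apply/eqP; rewrite mulf_eq0; apply/orP; right.
apply: contraLR le => /(graded_power_prod uniq_parts_upto) szi.
rewrite -leqNgt -[sumn rho]szi.
by rewrite -mem_parts_upto pt_in.
Qed.

Lemma power_table_free (v : 'rV[rat]_D.+1) : v *m power_table = 0 -> v = 0.
Proof.
move=> v0; apply: (power_mx_separate uniq_parts_upto parts_upto_down) => rho.
by have [//|[j [_ ->]]] := power_prod_normal v rho; rewrite v0 mxE.
Qed.

Lemma power_table_unit : power_table \in unitmx.
Proof.
rewrite -row_free_unit -kermx_eq0; apply/eqP/row_matrixP => i; rewrite row0.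
by apply: power_table_free; rewrite -row_mul mulmx_ker row0.
Qed.

(** By commutation an even part can be brought to the front of the word, next to [v]. Conversely,
    all words beginning with an even letter vanish on [v], and words separate. *)
Lemma even_power_rows (v : 'rV[rat]_D.+1) :
  (forall k, v *m p k.*2 = 0)
  <-> (forall j, ~~ all odd (pt j) -> (v *m power_table) 0 j = 0).
Proof.
split=> [vp j /allPn[x xj ox]|H k].
  rewrite power_tableE /power_prod.
  rewrite (power_prod_perm uniq_parts_upto parts_upto_down (perm_to_rem xj)) big_cons.
  by rewrite -(even_halfK ox) -mulmxE mulmxA vp mul0mx mxE.
apply: (power_mx_separate uniq_parts_upto parts_upto_down) => rho.
have -> : v *m p k.*2 *m \prod_(x <- rho) p x = v *m power_prod (k.*2 :: rho).
  by rewrite /power_prod big_cons -mulmxE mulmxA.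
have [//|[j [pe ->]]] := power_prod_normal v (k.*2 :: rho).
by apply: H; rewrite (perm_all _ pe) /= odd_double.
Qed.

Lemma homogeneous_rows (v : 'rV[rat]_D.+1) :
  (forall i, v 0 i != 0 -> sumn (pt i) = n)
  <-> (forall j, sumn (pt j) != n -> (v *m power_table) 0 j = 0).
Proof.
split=> [H j nj|H].
  rewrite mxE big1 // => i _; apply/eqP; rewrite mulf_eq0.
  case: (eqVneq (v 0 i) 0) => //= /H vi.
  by apply: contraR nj => /power_table_graded <-; apply/eqP.
(* [w] is the part of [v] outside degree [n]; the table is block diagonal by size, so the image of
   [w] is zero. *)
pose w : 'rV[rat]_D.+1 := \row_i (if sumn (pt i) == n then 0 else v 0 i).
have w0 : w = 0.
  apply: power_table_free; apply/rowP => j; rewrite [RHS]mxE.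
  have tab i : power_table i j = 0 \/ sumn (pt i) = sumn (pt j).
    by case: (eqVneq (power_table i j) 0) => [|/power_table_graded]; [left|right].
  case: (eqVneq (sumn (pt j)) n) => nj.
    rewrite mxE big1 // => i _; rewrite mxE; case: (tab i) => ->; first by rewrite mulr0.
    by rewrite nj eqxx mul0r.
  rewrite -(H j nj) !mxE; apply: eq_bigr => i _; rewrite mxE.
  by case: (tab i) => ->; rewrite ?mulr0 // (negPf nj).
move=> i; apply: contraNeq => ni; have /rowP/(_ i) := w0.
by rewrite !mxE (negPf ni) => ->.
Qed.

(** The equation [of_coords (coords r f) = f] says that [f] lives in degrees at most [n]; the
    vanishing entries combine homogeneity with the condition on even parts. *)
Lemma doubly_symmetric_coords f :
  homogeneous n f /\ doubly_symmetric f
  <-> of_coords (coords r f) = f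
      /\ (forall j, j \notin odd_indices -> (coords r f *m power_table) 0 j = 0).
Proof.
have ds (sub : {subset monalg.msupp f <= s}) : doubly_symmetric f
    <-> forall j, ~~ all odd (pt j) -> (coords r f *m power_table) 0 j = 0.
  rewrite (doubly_symmetric_words uniq_parts_upto parts_upto_down sub).
  rewrite -(row_eq_col_words uniq_parts_upto parts_upto_down).
  by rewrite (row_eq_colP uniq_parts_upto parts_upto_down) even_power_rows.
split=> [[hom dsf]|[fE zero]].
  have sub : {subset monalg.msupp f <= s}.
    by move=> la /hom E; rewrite mem_parts_upto E.
  split; first exact: of_coordsK uniq_parts_upto _ sub.
  move=> j; rewrite inE negb_and => /orP[|nj]; first exact: (proj1 (ds sub) dsf).
  move: j nj; apply/homogeneous_rows => i; rewrite mxE monalg.mcoeff_neq0.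
  exact: hom.
have hom : homogeneous n f.
  move=> la; rewrite -monalg.mcoeff_neq0 -fE mcoeff_of_coords => nz.
  have /existsP[i] : [exists i, (coords r f) 0 i * (pt i == la)%:R != 0].
    apply: contraR nz => /existsPn H0; apply/eqP/big1 => x _.
    by apply/eqP/negPn/H0.
  rewrite mulf_eq0 => /norP[nzi]; case: (pt i =P la) => [<- _|]; last by rewrite eqxx.
  have /homogeneous_rows hs : forall j, sumn (pt j) != n ->
      (coords r f *m power_table) 0 j = 0.
    by move=> j nj; apply: zero; rewrite inE (negPf nj) andbF.
  exact: hs nzi.
split=> //; apply/ds => [la /hom E|j nodd]; first by rewrite mem_parts_upto E.
by apply: zero; rewrite inE (negPf nodd).
Qed.

(** In the coordinates [v *m power_table] the space is spanned by coordinate vectors. The basis thus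
    consists of rows of the inverse table, that is, of the functions p_rho / z_rho with rho a
    partition of n into odd parts. *)
Lemma dim_doubly_symmetric :
  has_dim (fun f : symfun => homogeneous n f /\ doubly_symmetric f)
    #|odd_indices|.
Proof.
have PK := mulVmx power_table_unit.
pose b (x : 'I_#|odd_indices|) := matrix.row (enum_val x) (invmx power_table).
have bP (c : 'I_#|odd_indices| -> rat) :
    (\sum_x c x *: b x) *m power_table
    = \row_j \sum_x c x * (enum_val x == j)%:R.
  apply/rowP => j; rewrite mulmx_suml summxE mxE; apply: eq_bigr => x _.
  by rewrite -scalemxAl -row_mul PK !mxE.
exists (fun x => of_coords (b x)); split=> [c c0 x|f].
  have c0' : \sum_x c x *: b x = 0.
    by rewrite -(coordsK uniq_parts_upto (\sum_x c x *: b x)) of_coords_sum c0;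
       apply/rowP => i; rewrite !mxE monalg.mcoeff0.
  have /rowP/(_ (enum_val x)) := bP c; rewrite c0' mul0mx !mxE (bigD1 x) //=.
  rewrite eqxx mulr1 big1 ?addr0 => [|y ne]; first by move=> <-.
  by rewrite (inj_eq enum_val_inj) (negPf ne) mulr0.
rewrite doubly_symmetric_coords; split=> [[fE zero]|[c ->]].
  exists (fun x => (coords r f *m power_table) 0 (enum_val x)).
  rewrite -of_coords_sum -{1}fE; congr of_coords.
  apply: (can_inj (mulmxK power_table_unit)); rewrite bP; apply/rowP => j.
  rewrite [RHS]mxE -(big_enum_val
    (fun y => (coords r f *m power_table) 0 y * (y == j)%:R)) /=.
  case: (boolP (j \in odd_indices)) => jJ; last first.
    rewrite zero // big1 // => y yJ; case: eqP => [E|_]; last by rewrite mulr0.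
    by rewrite -E yJ in jJ.
  rewrite (bigD1 j) //= eqxx mulr1 big1 ?addr0 // => y /andP[_ ne].
  by rewrite (negPf ne) mulr0.
rewrite -of_coords_sum coordsK ?uniq_parts_upto //; split=> // j jJ.
rewrite bP mxE big1 // => x _; case: eqP => [E|_]; last by rewrite mulr0.
by rewrite -E enum_valP in jJ.
Qed.

End UptoN.

Theorem corollary3p11 :
  exists P : fps,
    is_fps_prod (fun k => fps_inv (fps_sub fps_one (fps_X (2 * k + 1)%N))) P
    /\ is_fps_prod (fun k => fps_add fps_one (fps_X (k + 1)%N)) P
    /\ (forall n : nat, exists d : nat,
          has_dim
            (fun f : symfun => homogeneous n f /\ doubly_symmetric f) d
          /\ d%:R = P n).
Proof.
exists odd_parts_series; split; first exact: is_fps_prod_odd.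
split; first exact: is_fps_prod_add1X.
move=> n; exists #|odd_indices n|; split; first exact: dim_doubly_symmetric.
by rewrite card_odd_indices.
Qed.
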